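(* Suppose that the communication graph $\mathcal{G}$ is strongly connected and that the payoff functions $f_1,\dots,f_N$ satisfy (A2), (A3), (A4) of the context. Then there exists a scalar $\epsilon\in(0,\epsilon^* )$ such that, under aperiodically intermittent communication satisfying the quasi-periodicity assumption $$\inf_m\{s_m-t_m\}=\bar\theta,\qquad \sup_m\{t_{m+1}-t_m\}=\bar T,\qquad 0<\bar\theta<\bar T<\infty,$$ and $$\rho=\mu_1\bar\theta-\mu_2(\bar T-\bar\theta)>0,$$ the system (S) of the context has the exponentially stable equilibrium point $(\mathbf{x}^*,\mathbf{1}_N\otimes\mathbf{x}^* )$.
   Context: **Graph.** $\mathcal{G}=(\mathcal{N},\mathcal{E})$ is a directed graph on $\mathcal{N}=\{1,\dots,N\}$ without self-loops, with weighted adjacency matrix $\mathcal{A}=(a_{ij})$, where $a_{ij}>0$ if $(j,i)\in\mathcal{E}$ and $a_{ij}=0$ otherwise ($a_{ii}=0$). The Laplacian is $\mathcal{L}=\mathcal{D}-\mathcal{A}$, $\mathcal{D}=\mathrm{diag}\{d_1^{in},\dots,d_N^{in}\}$, $d_i^{in}=\sum_{j}a_{ij}$. Strongly connected: every node has a directed path to every other node. Let $\mathcal{B}=\mathrm{diag}\{a_{ij}\}$ be the $N^2\times N^2$ diagonal matrix with entries $a_{11},a_{12},\dots,a_{1N},a_{21},\dots,a_{NN}$. For $\mathcal{G}$ strongly connected it is known that there are positive definite $N^2\times N^2$ matrices $P$ (diagonal) and $Q$ with $(\mathcal{L}\otimes I_N+\mathcal{B})^{\top}P+P(\mathcal{L}\otimes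 I_N+\mathcal{B})=Q$; fix such $P,Q$. **Game.** Player $i$ has action $x_i\in\mathbb{R}$ and payoff $f_i(\mathbf{x})$, $\mathbf{x}=(x_1,\dots,x_N)^\top\in\mathbb{R}^N$, to be maximized over $x_i$. A Nash equilibrium is $\mathbf{x}^*=(x_i^*,\mathbf{x}_{-i}^* )$ with $f_i(x_i,\mathbf{x}^*_{-i})\le f_i(x_i^*,\mathbf{x}_{-i}^* )$ for all $x_i\in\mathbb{R}$, $i\in\mathcal{N}$, where $\mathbf{x}_{-i}$ collects the actions of the players other than $i$. Put $\frac{\partial G}{\partial\mathbf{x}}(\mathbf{x})=\big(\frac{\partial f_1}{\partial x_1}(\mathbf{x}),\dots,\frac{\partial f_N}{\partial x_N}(\mathbf{x})\big)^\top$. Assumptions: - (A2) each $f_i$ is twice continuously differentiable; - (A3) there is $\alpha>0$ with $\big|\frac{\partial f_i}{\partial x_i}(\mathbf{x})-\frac{\partial f_i}{\partial x_i}(\mathbf{z})\big|\le\alpha|\mathbf{x}-\mathbf{z}|$ for all $i$ and $\mathbf{x},\mathbf{z}\in\mathbb{R}^N$; - (A4) each $f_i$ is concave in $x_i$, and there is $\beta>0$ with $(\mathbf{x}-\mathbf{z})^\top\big(\frac{\partial G}{\partial\mathbf{x}}(\mathbf{x})-\frac{\partial G}{\partial\mathbf{x}}(\mathbf{z})\big)\le-\beta|\mathbf{x}-\mathbf{z}|^2$ for all $\mathbf{x},\mathbf{z}\in\mathbb{R}^N$. These guarantee a unique Nash equilibrium $\mathbf{x}^*$, and $\frac{\partial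 G}{\partial\mathbf{x}}(\mathbf{x})=\mathbf{0}$ iff $\mathbf{x}=\mathbf{x}^*$. **System (S).** Let $0=t_0<s_0<t_1<s_1<\cdots$ with $t_m\to\infty$; $[t_m,s_m)$ is the $m$-th communication time and $[s_m,t_{m+1})$ the $m$-th silent time. Let $\bar k_i>0$ be constants and $\epsilon>0$. Player $i$ holds $\mathbf{y}_i=(y_{i1},\dots,y_{iN})^\top\in\mathbb{R}^N$ (its estimates of all actions), $\mathbf{y}=(\mathbf{y}_1^\top,\dots,\mathbf{y}_N^\top)^\top\in\mathbb{R}^{N^2}$. For all $i,j\in\mathcal{N}$: $$\dot x_i(t)=\epsilon\bar k_i\,\frac{\partial f_i}{\partial x_i}(\mathbf{y}_i(t)),$$ $$\dot y_{ij}(t)=-\Big(\sum_{k=1}^N a_{ik}(y_{ij}-y_{kj})+a_{ij}(y_{ij}-x_j)\Big)\ \text{for } t\in[t_m,s_m),\qquad \dot y_{ij}(t)=0\ \text{for } t\in[s_m,t_{m+1}).$$ **Constants.** It is known that under (A2)–(A4) there are a continuously differentiable function $\bar V$ and positive constants $\gamma_1,\dots,\gamma_5$ such that, with $\mathbf{e}=\mathbf{x}-\mathbf{x}^*$, for all $|\mathbf{e}|\le\gamma_5$: $\gamma_1|\mathbf{e}|^2\le\bar V(\mathbf{e})\le\gamma_2|\mathbf{e}|^2$, $\ \big(\frac{\partial\bar V}{\partial\mathbf{e}}\big)^\top\mathrm{diag}\{\bar k_i\}\frac{\partial G}{\partial\mathbf{x}}(\mathbf{x})\le-\gamma_3|\mathbf{e}|^2$,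 $\ \big|\frac{\partial\bar V}{\partial\mathbf{e}}\big|\le\gamma_4|\mathbf{e}|$. Fix these. Let $\Vert P\Vert$ be the induced norm and $\lambda_{\min},\lambda_{\max}$ the extreme eigenvalues. Put $$\pi_1=\alpha\max_i\{\bar k_i\}\big(\tfrac{\gamma_4}{2}+N\Vert P\Vert\big),\quad \pi_2=2\alpha\sqrt N\,\Vert P\Vert\max_i\{\bar k_i\},$$ $$\epsilon_1^*=\frac{\gamma_3\lambda_{\min}(Q)}{\gamma_3\pi_2+\pi_1^2},\quad \epsilon_2^*=\frac{\gamma_3^2\pi_2^2}{\pi_1^4},\quad \epsilon^*=\min\{\epsilon_1^*,\epsilon_2^*\},$$ $$\Gamma_1=\begin{pmatrix}\epsilon\gamma_3&-\epsilon\pi_1\\-\epsilon\pi_1&\lambda_{\min}(Q)-\epsilon\pi_2\end{pmatrix},\quad \Gamma_2=\begin{pmatrix}\sqrt\epsilon\,\gamma_3&\epsilon\pi_1\\ \epsilon\pi_1&\epsilon\pi_2\end{pmatrix}.$$ With $\mathbf{e}_{\mathbf{x}}=\mathbf{y}-\mathbf{1}_N\otimes\mathbf{x}$, let $V(\mathbf{e},\mathbf{e}_{\mathbf{x}})=\bar V(\mathbf{e})+\mathbf{e}_{\mathbf{x}}^\top P\mathbf{e}_{\mathbf{x}}$, and let $\eta_1,\eta_2>0$ be fixed constants with $\eta_1(|\mathbf{e}|^2+|\mathbf{e}_{\mathbf{x}}|^2)\le V\le\eta_2(|\mathbf{e}|^2+|\mathbf{e}_{\mathbf{x}}|^2)$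 (for $|\mathbf{e}|\le\gamma_5$). Set $\mu_1=\lambda_{\min}(\Gamma_1)/\eta_2$ and $\mu_2=\lambda_{\max}(\Gamma_2)/\eta_1$ (both depend on $\epsilon$). **Exponential stability** of an equilibrium $z^*$ of (S) means: there are $\delta,c,\lambda>0$ such that every solution $z(t)=(\mathbf{x}(t),\mathbf{y}(t))$ starting at $t=0$ with $|z(0)-z^*|<\delta$ satisfies $|z(t)-z^*|\le c|z(0)-z^*|e^{-\lambda t}$ for all $t\ge0$. *)

(* Defs.v *)
From HB Require Import structures.
From mathcomp Require Import all_boot all_order all_algebra.
From mathcomp Require Import all_classical all_reals all_analysis.
From mathcomp Require Export mxtens.

Set Implicit Arguments.
Unset Strict Implicit.
Unset Printing Implicit Defensive.

Import Order.TTheory GRing.Theory Num.Theory.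
Import numFieldNormedType.Exports.

Local Open Scope classical_set_scope.
Local Open Scope ring_scope.

Section LinearAlgebra.
Variable R : realType.

(* The norm that the library puts on matrices is the sup norm. *)
Definition enorm n (v : 'cV[R]_n) : R := Num.sqrt (\sum_i v i 0 ^+ 2).

Definition opnorm n (M : 'M[R]_n) : R :=
  sup [set enorm (M *m v) | v in [set v | enorm v = 1]].

Definition qform n (M : 'M[R]_n) (v : 'cV[R]_n) : R := (v^T *m M *m v) 0 0.

Definition posdef n (M : 'M[R]_n) : Prop :=
  M^T = M /\ forall v : 'cV[R]_n, v != 0 -> 0 < qform M v.

(* Applied to symmetric matrices of positive size only: the spectrum is then
   real, finite and nonempty. *)
Definition lambda_min n (M : 'M[R]_n) : R := inf [set a : R | eigenvalue M a].
Definition lambda_max n (M : 'M[R]_n) : R := sup [set a : R | eigenvalue M a].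

Definition mx22 (a b c d : R) : 'M[R]_2 :=
  block_mx (a%:M : 'M[R]_1) (b%:M : 'M[R]_1) (c%:M : 'M[R]_1) (d%:M : 'M[R]_1).

End LinearAlgebra.

Section Calculus.
Variables (R : realType) (n : nat).
Implicit Type g : 'cV[R]_n -> R.

Definition partial (i : 'I_n) g (x : 'cV[R]_n) : R := 'D_(delta_mx i 0) g x.

Definition grad g (x : 'cV[R]_n) : 'cV[R]_n := \col_i partial i g x.

Definition C1 g : Prop := (forall x, differentiable g x) /\ continuous (grad g).

Definition C2 g : Prop := C1 g /\ forall i, C1 (partial i g).

(* Derivative at t relative to D: one-sided at an endpoint that belongs to D,
   two-sided at interior points. *)
Definition is_derive_within (D : set R) (u : R -> R) (t l : R) : Prop :=
  (fun r => (u r - u t) / (r - t)) @ within D t^' --> l.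

End Calculus.

Section Graph.
Variables (R : realType) (N : nat).
Implicit Types (E : rel 'I_N) (A : 'M[R]_N).

(* E j i stands for the edge (j, i), from j to i. *)
Definition weighted_adjacency E A : Prop :=
  forall i j, if E j i then 0 < A i j else A i j == 0.

Definition strongly_connected E : Prop := forall i j, connect E i j.

Definition laplacian A : 'M[R]_N := diag_mx (\row_i \sum_j A i j) - A.

(* Pairs (i, j) index R^(N^2) in the order 11, 12, ..., 1N, 21, ..., NN. *)
Definition Bmx A : 'M[R]_(N * N) :=
  diag_mx (\row_p A (mxtens_unindex p).1 (mxtens_unindex p).2).

Definition LBmx A : 'M[R]_(N * N) := laplacian A *t (1%:M : 'M[R]_N) + Bmx A.

Definition ones_tens (x : 'cV[R]_N) : 'cV[R]_(N * N) :=
  (const_mx 1 : 'cV[R]_N) *t x.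

End Graph.

Section Game.
Variables (R : realType) (N : nat).
Implicit Type f : 'I_N -> 'cV[R]_N -> R.

Definition set_action (x : 'cV[R]_N) (i : 'I_N) (a : R) : 'cV[R]_N :=
  \col_j (if j == i then a else x j 0).

Definition nash f (xs : 'cV[R]_N) : Prop :=
  forall i a, f i (set_action xs i a) <= f i xs.

Definition dG f (x : 'cV[R]_N) : 'cV[R]_N := \col_i partial i (f i) x.

Definition lipschitz_dG f (alpha : R) : Prop :=
  forall i x z,
    `|partial i (f i) x - partial i (f i) z| <= alpha * enorm (x - z).

Definition concave_own f : Prop :=
  forall i x,
    @convex_function R R^o setT (fun a : R^o => - f i (set_action x i a)).

Definition strongly_monotone_dG f (beta : R) : Prop :=
  forall x z,
    ((x - z)^T *m (dG f x - dG f z)) 0 0 <= - beta * enorm (x - z) ^+ 2.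

End Game.

Section System.
Variables (R : realType) (N : nat).

Definition intermittent (t s : nat -> R) : Prop :=
  [/\ t 0%N = 0, forall m, t m < s m, forall m, s m < t m.+1
    & t @ \oo --> +oo].

(* A state stacks the actions x and the estimates y. *)
Local Notation state := 'cV[R]_(N + N * N).

Definition act (z : state) (j : 'I_N) : R := usubmx z j 0.

Definition est (z : state) (i : 'I_N) : 'cV[R]_N :=
  \col_j dsubmx z (mxtens_index (i, j)) 0.

Definition act_field (eps : R) (k : 'I_N -> R) (f : 'I_N -> 'cV[R]_N -> R)
    (z : state) (i : 'I_N) : R :=
  eps * k i * partial i (f i) (est z i).

Definition est_field (A : 'M[R]_N) (z : state) (i j : 'I_N) : R :=
  - (\sum_k A i k * (est z i j 0 - est z k j 0)
     + A i j * (est z i j 0 - act z j)).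

(* The field of the estimates jumps at the switching times, hence the
   derivatives within half-open intervals together with continuity. *)
Definition solution (A : 'M[R]_N) (f : 'I_N -> 'cV[R]_N -> R)
    (k : 'I_N -> R) (eps : R) (t s : nat -> R) (z : R -> state) : Prop :=
  [/\ {within `[0, +oo[, continuous z},
      forall i (tau : R), tau \in `[0, +oo[ ->
        is_derive_within `[0, +oo[ (fun r => act (z r) i) tau
          (act_field eps k f (z tau) i),
      forall m i j tau, tau \in `[t m, s m[ ->
        is_derive_within `[t m, s m[ (fun r => est (z r) i j 0) tau
          (est_field A (z tau) i j)
    & forall m i j tau, tau \in `[s m, t m.+1[ ->
        is_derive_within `[s m, t m.+1[ (fun r => est (z r) i j 0) tau 0].

End System.

Section Stability.
Variables (R : realType) (n : nat) (sol : (R -> 'cV[R]_n) -> Prop).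

Definition equilibrium (zs : 'cV[R]_n) : Prop := sol (fun=> zs).

Definition exponentially_stable (zs : 'cV[R]_n) : Prop :=
  exists delta c lambda : R,
    [/\ 0 < delta, 0 < c, 0 < lambda &
      forall z, sol z -> enorm (z 0 - zs) < delta ->
        forall tau, 0 <= tau ->
          enorm (z tau - zs) <= c * enorm (z 0 - zs) * expR (- lambda * tau)].

End Stability.

Section Constants.
Variables (R : realType) (N : nat).
Variables (P Q : 'M[R]_(N * N)) (k : 'I_N -> R).
Variables (alpha gamma3 gamma4 : R).

(* The gains are positive, so the default value 0 is harmless. *)
Definition kmax : R := \big[Num.max/0]_i k i.

Definition pi1 : R := alpha * kmax * (gamma4 / 2 + N%:R * opnorm P).

Definition pi2 : R := 2 * alpha * Num.sqrt N%:R * opnorm P * kmax.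

Definition eps1 : R :=
  gamma3 * lambda_min Q / (gamma3 * pi2 + pi1 ^+ 2).

Definition eps2 : R := gamma3 ^+ 2 * pi2 ^+ 2 / pi1 ^+ 4.

Definition eps_star : R := Num.min eps1 eps2.

Definition Gamma1 (eps : R) : 'M[R]_2 :=
  mx22 (eps * gamma3) (- (eps * pi1))
       (- (eps * pi1)) (lambda_min Q - eps * pi2).

Definition Gamma2 (eps : R) : 'M[R]_2 :=
  mx22 (Num.sqrt eps * gamma3) (eps * pi1)
       (eps * pi1) (eps * pi2).

Definition mu1 (eta2 eps : R) : R := lambda_min (Gamma1 eps) / eta2.

Definition mu2 (eta1 eps : R) : R := lambda_max (Gamma2 eps) / eta1.

End Constants.

Section Lyapunov.
Variables (R : realType) (N : nat).

Definition lyapunov_reduced (f : 'I_N -> 'cV[R]_N -> R) (k : 'I_N -> R)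
    (xs : 'cV[R]_N) (Vbar : 'cV[R]_N -> R)
    (gamma1 gamma2 gamma3 gamma4 gamma5 : R) : Prop :=
  C1 Vbar /\
  forall e : 'cV[R]_N, enorm e <= gamma5 ->
    [/\ gamma1 * enorm e ^+ 2 <= Vbar e <= gamma2 * enorm e ^+ 2,
        ((grad Vbar e)^T *m diag_mx (\row_i k i) *m dG f (xs + e)) 0 0
          <= - gamma3 * enorm e ^+ 2
      & enorm (grad Vbar e) <= gamma4 * enorm e].

Definition V (Vbar : 'cV[R]_N -> R) (P : 'M[R]_(N * N))
    (e : 'cV[R]_N) (ex : 'cV[R]_(N * N)) : R := Vbar e + qform P ex.

Definition V_bounds (Vbar : 'cV[R]_N -> R) (P : 'M[R]_(N * N))
    (gamma5 eta1 eta2 : R) : Prop :=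
  forall (e : 'cV[R]_N) (ex : 'cV[R]_(N * N)), enorm e <= gamma5 ->
    eta1 * (enorm e ^+ 2 + enorm ex ^+ 2) <= V Vbar P e ex
      <= eta2 * (enorm e ^+ 2 + enorm ex ^+ 2).

End Lyapunov.

(* Main.v *)
(* With e = x - x* and e_x = y - 1 (x) x, the energy V = Vbar(e) + e_x^T P e_x
   satisfies, as long as |e| <= gamma5,
     V' <= - gamma3 eps |e|^2 + 2 eps pi1 |e| |e_x| + eps pi2 |e_x|^2 - e_x^T Q e_x
   while the players communicate, and the same bound without the Q-term while
   they are silent. The Rayleigh quotients of Gamma1 and Gamma2 turn this into
   V' <= - mu1 V and V' <= mu2 V, for every eps < eps_star. Hence V is multiplied
   by at most exp(- rho) over each period and never exceeds a fixed multiple of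
   its initial value; a continuation argument then keeps |e| below gamma5 when
   the initial state is close enough to the equilibrium. *)
Require Import Defs.
From HB Require Import structures.
From mathcomp Require Import all_boot all_order all_algebra.
From mathcomp Require Import all_classical all_reals all_analysis.
From mathcomp Require Import ring lra.

Set Implicit Arguments.
Unset Strict Implicit.
Unset Printing Implicit Defensive.

Import Order.TTheory GRing.Theory Num.Theory.
Import numFieldNormedType.Exports.

Local Open Scope classical_set_scope.
Local Open Scope ring_scope.

(** * Euclidean norm, operator norm and Rayleigh quotients *)

Section Euclidean.
Variable R : realType.

(** The rates are available only where |e| <= gamma5, while this smallness is itself to be drawn
    from the decay of V. To break the circle, the decay estimate along a solution is stated up to a
    time [tau] until which smallness is assumed; the continuation argument then discharges the
    assumption. The field of the estimates jumps at the switching times, so V need not be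
    differentiable there: each phase uses derivatives in its open interior only, and continuity
    glues consecutive phases. The extreme eigenvalues are given as [inf] and [sup] of a spectrum, so
    the Rayleigh bounds are derived from the compactness of the Euclidean unit sphere. *)

Definition dot n (u v : 'cV[R]_n) : R := (u^T *m v) 0 0.

Section Dot.
Variable n : nat.
Implicit Types u v w : 'cV[R]_n.

Lemma dotE u v : dot u v = \sum_i u i 0 * v i 0.
Proof. by rewrite /dot mxE; apply: eq_bigr => i _; rewrite mxE. Qed.

Lemma dotC u v : dot u v = dot v u.
Proof. by rewrite !dotE; apply: eq_bigr => i _; rewrite mulrC. Qed.

Lemma dotDr u v w : dot u (v + w) = dot u v + dot u w.
Proof. by rewrite /dot mulmxDr mxE. Qed.

Lemma dotZr a u v : dot u (a *: v) = a * dot u v.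
Proof. by rewrite /dot -scalemxAr mxE. Qed.

Lemma dotNr u v : dot u (- v) = - dot u v.
Proof. by rewrite -scaleN1r dotZr mulN1r. Qed.

Lemma dotDl u v w : dot (u + v) w = dot u w + dot v w.
Proof. by rewrite dotC dotDr !(dotC w). Qed.

Lemma dotZl a u v : dot (a *: u) v = a * dot u v.
Proof. by rewrite dotC dotZr dotC. Qed.

Lemma dotNl u v : dot (- u) v = - dot u v.
Proof. by rewrite dotC dotNr dotC. Qed.

Lemma sqr_enorm u : enorm u ^+ 2 = dot u u.
Proof.
rewrite /enorm sqr_sqrtr ?sumr_ge0 // => [|i _]; last exact: sqr_ge0.
by rewrite dotE; apply: eq_bigr => i _; rewrite expr2.
Qed.

Lemma sqr_enormE u : enorm u ^+ 2 = \sum_i u i 0 ^+ 2.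
Proof. by rewrite sqr_enorm dotE; apply: eq_bigr => i _; rewrite expr2. Qed.

Lemma enorm_ge0 u : 0 <= enorm u.
Proof. exact: sqrtr_ge0. Qed.

Lemma coord_le_enorm u i : `|u i 0| <= enorm u.
Proof.
rewrite -[leLHS]sqrtr_sqr ler_sqrt ?sumr_ge0 // => [|j _]; last exact: sqr_ge0.
by rewrite (bigD1 i) //= lerDl sumr_ge0 // => j _; exact: sqr_ge0.
Qed.

Lemma enorm_eq0 u : (enorm u == 0) = (u == 0).
Proof.
apply/eqP/eqP => [u0|->].
  apply/colP => i; rewrite mxE; apply/eqP; rewrite -normr_le0 -u0.
  exact: coord_le_enorm.
by rewrite /enorm big1 ?sqrtr0 // => i _; rewrite mxE expr0n.
Qed.

Lemma enormZ a u : enorm (a *: u) = `|a| * enorm u.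
Proof.
rewrite -sqrtr_sqr /enorm -sqrtrM ?sqr_ge0 // mulr_sumr; congr Num.sqrt.
by apply: eq_bigr => i _; rewrite mxE exprMn.
Qed.

Lemma enormN u : enorm (- u) = enorm u.
Proof. by rewrite -scaleN1r enormZ normrN1 mul1r. Qed.

(** Cauchy-Schwarz: |<v,v> u - <u,v> v|^2 expands to <v,v> (|u|^2 |v|^2 - <u,v>^2), and the positive
    factor <v,v> cancels. *)
Lemma dot_enorm_le u v : `|dot u v| <= enorm u * enorm v.
Proof.
have [->|v0] := eqVneq v 0.
  by rewrite dotE big1 ?normr0 ?mulr_ge0 ?enorm_ge0 // => i _; rewrite mxE mulr0.
have b0 : 0 < dot v v by rewrite -sqr_enorm exprn_gt0 // lt_def enorm_eq0 v0 enorm_ge0.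
rewrite -(ler_pXn2r (n := 2)) ?nnegrE ?mulr_ge0 ?enorm_ge0 // exprMn !sqr_enorm.
rewrite real_normK ?num_real // -subr_ge0 -(pmulr_rge0 _ b0).
have := sqr_ge0 (enorm (dot v v *: u - dot u v *: v)).
rewrite sqr_enorm !(dotDl, dotDr, dotNl, dotNr, dotZl, dotZr) (dotC v u).
by move=> H; apply: le_trans H _; rewrite le_eqVlt; apply/orP; left; apply/eqP; ring.
Qed.

Lemma enormD u v : enorm (u + v) <= enorm u + enorm v.
Proof.
rewrite -(ler_pXn2r (n := 2)) ?nnegrE ?addr_ge0 ?enorm_ge0 // sqrrD !sqr_enorm.
rewrite !(dotDl, dotDr) (dotC v u).
have := le_trans (ler_norm _) (dot_enorm_le u v); lra.
Qed.

Lemma enorm_sum_le u : enorm u <= \sum_i `|u i 0|.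
Proof.
rewrite -(ler_pXn2r (n := 2)) ?nnegrE ?enorm_ge0 ?sumr_ge0 //.
rewrite sqr_enormE expr2 mulr_suml ler_sum // => i _.
rewrite -real_normK ?num_real // expr2 ler_wpM2l // (bigD1 i) //= lerDl.
exact: sumr_ge0.
Qed.

End Dot.

Lemma enorm_mulmx_le n (M : 'M[R]_n) (v : 'cV[R]_n) :
  enorm (M *m v) <= opnorm M * enorm v.
Proof.
have [->|v0] := eqVneq v 0.
  by rewrite mulmx0 (_ : enorm _ = 0) ?mulr0 //; apply/eqP; rewrite enorm_eq0.
have nv : 0 < enorm v by rewrite lt_def enorm_eq0 v0 enorm_ge0.
rewrite -ler_pdivrMr // mulrC -[X in X * _]gtr0_norm ?invr_gt0 // -enormZ scalemxAr.
apply: sup_upper_bound.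
  split.
    exists (enorm (M *m ((enorm v)^-1 *: v))); exists ((enorm v)^-1 *: v) => //=.
    by rewrite enormZ gtr0_norm ?invr_gt0 // mulVf // gt_eqF.
  (* A supremum is informative only for a bounded set; the sum of all |M_ij| is a bound because the
     coordinates of a unit vector are at most 1 in absolute value. *)
  exists (\sum_i \sum_j `|M i j|) => _ [w /= w1 <-].
  apply: le_trans (enorm_sum_le _) _; apply: ler_sum => i _; rewrite mxE.
  apply: le_trans (ler_norm_sum _ _ _) _; apply: ler_sum => j _.
  by rewrite normrM ler_piMr // -w1 coord_le_enorm.
exists ((enorm v)^-1 *: v) => //=.
by rewrite enormZ gtr0_norm ?invr_gt0 // mulVf // gt_eqF.
Qed.

Lemma opnorm_ge0 n (M : 'M[R]_n) : 0 <= opnorm M.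
Proof.
have [[v v1]|noU] := pselect (exists v : 'cV[R]_n, enorm v = 1).
  by rewrite -[opnorm M]mulr1 -v1 (le_trans (enorm_ge0 _) (enorm_mulmx_le _ _)).
(* Without unit vectors (dimension 0) the supremum is taken over the empty set, where its value is 0
   by convention. *)
rewrite /opnorm (_ : [set _ | _ in _] = set0) ?sup0 //.
by apply/seteqP; split => // x [v v1 _]; apply: noU; exists v.
Qed.

Section Rayleigh.
Variable n : nat.
Implicit Types (M : 'M[R]_n) (u v w : 'cV[R]_n).

Lemma qform_dot M v : qform M v = dot v (M *m v).
Proof. by rewrite /qform /dot mulmxA. Qed.

Lemma dot_sym M u v : M^T = M -> dot u (M *m v) = dot v (M *m u).
Proof. by move=> symM; rewrite dotC /dot trmx_mul symM mulmxA. Qed.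

Lemma continuous_qform M : continuous (@qform R n M).
Proof.
move=> u; apply: differentiable_continuous.
have -> : @qform R n M = \sum_i \sum_j ((fun v : 'cV[R]_n => v i 0) *
    (cst (M i j) * (fun v : 'cV[R]_n => v j 0))).
  apply/funext => v; rewrite qform_dot dotE fct_sumE; apply: eq_bigr => i _.
  by rewrite fct_sumE !mxE mulr_sumr; apply: eq_bigr.
apply: differentiable_sum => i; apply: differentiable_sum => j.
apply: differentiableM; first exact: differentiable_coord.
apply: differentiableM; [exact: differentiable_cst|exact: differentiable_coord].
Qed.

Lemma enorm_qform v : enorm v = Num.sqrt (qform 1%:M v).
Proof. by rewrite qform_dot mul1mx -sqr_enorm sqrtr_sqr ger0_norm ?enorm_ge0. Qed.

Lemma continuous_enorm : continuous (@enorm R n).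
Proof.
rewrite (_ : @enorm R n = Num.sqrt \o qform 1%:M); last first.
  by apply/funext => v; exact: enorm_qform.
move=> v; apply: continuous_comp; first exact: continuous_qform.
exact: sqrt_continuous.
Qed.

Lemma cvg_cV (T : Type) (F : set_system T) (e : T -> 'cV[R]_n) (l : 'cV[R]_n) :
  Filter F -> (forall i, e x i 0 @[x --> F] --> l i 0) -> e x @[x --> F] --> l.
Proof.
move=> FF el; apply/cvgrPdist_le => /= c c0; near=> x.
rewrite [leLHS]/Num.Def.normr /= mx_normrE (bigmax_le _ (ltW c0)) //= => i _.
rewrite !mxE (ord1 i.2); move: i; near: x; apply: filter_forall => /= i.
by move/cvgrPdist_le : (el i.1); apply.
Unshelve. all: by end_near. Qed.

Lemma continuous_cV (T : topologicalType) (e : T -> 'cV[R]_n) :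
  (forall i, continuous (fun x => e x i 0)) -> continuous e.
Proof. by move=> ce x; apply: cvg_cV => i; exact: ce. Qed.

Lemma continuous_trmx : continuous (fun r : 'rV[R]_n => r^T).
Proof.
apply: continuous_cV => i.
rewrite (_ : (fun x : 'rV_n => x^T i 0) = (fun x => x 0 i)).
  exact: coord_continuous.
by apply/funext => x; rewrite mxE.
Qed.

Lemma qformZ M a v : qform M (a *: v) = a ^+ 2 * qform M v.
Proof. by rewrite !qform_dot -scalemxAr dotZl dotZr mulrA expr2. Qed.

(** The sphere is closed, and bounded because the sup norm is dominated by the Euclidean one.
    Compactness is obtained for row vectors, hence the transposes. *)
Lemma unit_sphere_compact : compact [set r : 'rV[R]_n | enorm r^T = 1].
Proof.
apply: bounded_closed_compact.
  exists 1; split; first exact: num_real.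
  move=> x x1 r /= r1; rewrite [leLHS]/Num.Def.normr /= mx_normrE.
  apply: bigmax_le => [|[i j] _] /=.
    by rewrite (le_trans _ (ltW x1)).
  apply: le_trans (ltW x1); rewrite -r1 (ord1 i).
  by have := coord_le_enorm r^T j; rewrite mxE.
apply: (@closed_comp _ _ (fun r : 'rV[R]_n => enorm r^T) [set 1]); last exact: closed_eq.
move=> r _; apply: continuous_comp; first exact: continuous_trmx.
exact: continuous_enorm.
Qed.

(** First-order condition for the Rayleigh quotient: moving from [v] along the residual
    [d = M v - m v] changes the nonnegative form [qform M w - m |w|^2], which vanishes at [v], to 2
    h |d|^2 + h^2 c. *)
Lemma min_qform_eigen M v : M^T = M -> enorm v = 1 ->
  (forall w, qform M v * enorm w ^+ 2 <= qform M w) -> M *m v = qform M v *: v.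
Proof.
move=> symM v1 vmin; set m := qform M v in vmin *.
have [d dE] : exists d, d = M *m v - m *: v by exists (M *m v - m *: v).
suff : dot d d = 0.
  rewrite -sqr_enorm => /eqP; rewrite expf_eq0 /= enorm_eq0 dE subr_eq0.
  by move/eqP.
have c0 := vmin d; rewrite -subr_ge0 in c0; set c := _ - _ in c0.
have H h : 0 <= 2 * h * dot d d + h ^+ 2 * c.
  have := vmin (v + h *: d); rewrite -subr_ge0 => /le_trans; apply.
  rewrite le_eqVlt; apply/orP; left; apply/eqP.
  have ddE : dot d d = dot d (M *m v) - m * dot d v.
    by rewrite [in X in dot d X]dE dotDr dotNr dotZr.
  rewrite ddE /c !sqr_enorm !qform_dot mulmxDr -scalemxAr.
  rewrite !(dotDl, dotDr, dotZl, dotZr) (dot_sym v d symM) (dotC v d).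
  have -> : dot v (M *m v) = m * dot v v.
    by rewrite -qform_dot -sqr_enorm v1 expr1n mulr1.
  ring.
(* The quadratic [2 h |d|^2 + h^2 c] is nonnegative for all h; its value at
   [h = - |d|^2 / (c + 1)] forces d = 0. *)
have c1 : 0 < c + 1 by lra.
have /(mulr_ge0 (sqr_ge0 (c + 1))) := H (- dot d d / (c + 1)).
have -> : (c + 1) ^+ 2 * (2 * (- dot d d / (c + 1)) * dot d d +
    (- dot d d / (c + 1)) ^+ 2 * c) = - (dot d d ^+ 2 * (c + 2)).
  by field; rewrite gt_eqF.
rewrite oppr_ge0 pmulr_lle0; last by lra.
by move=> H2; apply/eqP; rewrite -sqrf_eq0 eq_le H2 sqr_ge0.
Qed.

(** The minimum over the compact unit sphere, nonempty as n > 0, extends to all vectors because both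
    sides are homogeneous of degree two. *)
Lemma rayleigh_min M : (0 < n)%N -> M^T = M ->
  exists v, [/\ enorm v = 1, M *m v = qform M v *: v &
    forall w, qform M v * enorm w ^+ 2 <= qform M w].
Proof.
move=> n_gt0 symM; pose i0 := Ordinal n_gt0.
have [] := @compact_EVT_min _ _ (fun r : 'rV[R]_n => qform M r^T)
    [set r | enorm r^T = 1] _ unit_sphere_compact;
  [| |move=> r rS rmin].
- exists (delta_mx 0 i0) => /=; apply/eqP.
  rewrite -(@pexpr_eq1 _ _ 2) ?enorm_ge0 // sqr_enormE (bigD1 i0) //= big1.
    by rewrite !mxE !eqxx expr1n addr0.
  by move=> i ni; rewrite !mxE (negbTE ni) andbF expr0n.
- apply: continuous_subspaceT => r.
  apply: continuous_comp; first exact: continuous_trmx.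
  exact: continuous_qform.
rewrite inE /= in rS.
have vmin w : qform M r^T * enorm w ^+ 2 <= qform M w.
  have [->|w0] := eqVneq w 0.
    by rewrite -(scale0r 0) enormZ normr0 mul0r qformZ expr0n mulr0 mul0r.
  have nw : 0 < enorm w by rewrite lt_def enorm_eq0 w0 enorm_ge0.
  have := rmin ((enorm w)^-1 *: w)^T; rewrite trmxK qformZ inE /= trmxK enormZ.
  rewrite ger0_norm ?invr_ge0 ?enorm_ge0 // mulVf ?gt_eqF // => /(_ erefl).
  by rewrite exprVn mulrC ler_pdivlMr // exprn_gt0.
exists r^T; split => //; exact: min_qform_eigen.
Qed.

(** [eigenvalue] refers to row eigenvectors; symmetry turns their transposes into column
    eigenvectors, which are then normalised. *)
Lemma eigenvalue_qform M a : M^T = M -> eigenvalue M a ->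
  exists2 v, enorm v = 1 & qform M v = a.
Proof.
move=> symM /eigenvalueP[r rM r0].
have n0 : 0 < enorm r^T.
  rewrite lt_def enorm_ge0 enorm_eq0 andbT; apply: contra r0 => /eqP r0.
  by rewrite -(trmxK r) r0 trmx0.
have E1 : enorm ((enorm r^T)^-1 *: r^T) = 1.
  by rewrite enormZ ger0_norm ?invr_ge0 ?enorm_ge0 // mulVf // gt_eqF.
exists ((enorm r^T)^-1 *: r^T) => //.
rewrite qform_dot -scalemxAr -[M in M *m _]symM -trmx_mul rM linearZ /=.
by rewrite scalerA mulrC -scalerA dotZr -sqr_enorm E1 expr1n mulr1.
Qed.

(** The least Rayleigh quotient is an eigenvalue, and every eigenvalue is a Rayleigh quotient; so
    the infimum of the spectrum is that least quotient. *)
Lemma lambda_min_attained M : (0 < n)%N -> M^T = M ->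
  (forall w, lambda_min M * enorm w ^+ 2 <= qform M w) /\
  exists2 v, enorm v = 1 & qform M v = lambda_min M.
Proof.
move=> n_gt0 symM; have [v [v1 vE vmin]] := rayleigh_min n_gt0 symM.
suff -> : lambda_min M = qform M v by split => //; exists v.
have ev : [set a | eigenvalue M a] (qform M v).
  apply/eigenvalueP; exists v^T; first by rewrite -[M in LHS]symM -trmx_mul {1}vE linearZ.
  apply/eqP => /(congr1 trmx); rewrite trmxK trmx0 => /eqP.
  by rewrite -enorm_eq0 v1 oner_eq0.
have lb : lbound [set a | eigenvalue M a] (qform M v).
  move=> a /= /(eigenvalue_qform symM)[w w1 <-].
  by have := vmin w; rewrite w1 expr1n mulr1.
apply/eqP; rewrite eq_le; apply/andP; split.
  by apply: ge_inf => //; exists (qform M v).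
by apply: lb_le_inf => //; exists (qform M v).
Qed.

Lemma lambda_max_ge M w : (0 < n)%N -> M^T = M ->
  qform M w <= lambda_max M * enorm w ^+ 2.
Proof.
move=> n_gt0 symM.
have symN : (- M)^T = - M by rewrite linearN /= symM.
have [/(_ w) + _] := lambda_min_attained n_gt0 symN.
have qN u : qform (- M) u = - qform M u.
  by rewrite !qform_dot mulNmx dotNr.
(* [inf] unfolds to minus the [sup] of the opposite set, and the spectrum of -M is the opposite of
   the spectrum of M. *)
have -> : lambda_min (- M) = - lambda_max M.
  rewrite /lambda_min /inf /lambda_max; congr (- sup _).
  have eN (B : 'M[R]_n) a : eigenvalue B a -> eigenvalue (- B) (- a).
    move=> /eigenvalueP[r rB r0]; apply/eigenvalueP; exists r => //.
    by rewrite mulmxN rB scaleNr.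
  apply/seteqP; split => [_ [a /= Ma <-]|a /= Ma].
    by rewrite -[M]opprK; exact: eN.
  by exists (- a); [exact: eN|rewrite opprK].
by rewrite qN mulNr lerN2.
Qed.

End Rayleigh.
End Euclidean.

(** * Derivatives and differential inequalities *)

Section Calculus.
Variable R : realType.
Implicit Types (u h : R -> R).

Lemma is_derive_within_derive (D : set R) u (t l : R) :
  nbhs t D -> is_derive_within D u t l -> is_derive t 1 u l.
Proof.
move=> nD ul.
have H : h^-1 *: (u (h *: 1 + t) - u t) @[h --> 0^'] --> l.
  move=> U lU; have [e /= e0 He] := ul U lU; have [d /= d0 Hd] := nD.
  exists (Num.min e d); first by rewrite /= lt_min e0.
  move=> h /=; rewrite sub0r normrN lt_min => /andP[he hd] h0.
  have ht : h = (h *: 1 + t) - t by rewrite addrK [_ *: _]mulr1.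
  have nt : `|t - (h *: 1 + t)| = `|h| by rewrite distrC -ht.
  have := He (h *: 1 + t); rewrite /= nt => /(_ he); rewrite -ht -subr_eq0 -ht.
  move=> /(_ h0 (Hd _ _)); rewrite /= nt => /(_ hd).
  by rewrite mulrC.
by apply: DeriveDef; [apply/cvg_ex; exists l|exact: cvg_lim H].
Qed.

Lemma is_derive_grad_comp n (g : 'cV[R]_n -> R) (e : R -> 'cV[R]_n) (t : R)
    (d : 'cV[R]_n) :
  differentiable g (e t) ->
  (forall j, is_derive t 1 (fun r => e r j 0) (d j 0)) ->
  is_derive t 1 (g \o e) (dot (grad g (e t)) d).
Proof.
move=> dg de.
have dre : derivable e t 1.
  apply/derivable_mxP => i j; rewrite (ord1 j); by have [] := de i.
have De : 'D_1 e t = d.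
  rewrite derive_mx //; apply/colP => j; rewrite mxE.
  by have [_ ->] := de j.
have dfe : differentiable e t by apply/derivable1_diffP.
have dge : differentiable (g \o e) t by exact: differentiable_comp.
apply: DeriveDef; first exact: diff_derivable.
rewrite deriveE // diff_comp //= -(deriveE _ dfe) De.
have -> : d = \sum_j d j 0 *: delta_mx j 0.
  rewrite [LHS]matrix_sum_delta; apply: eq_bigr => j _.
  by rewrite big_ord1.
rewrite linear_sum dotE; apply: eq_bigr => j _.
rewrite linearZ /= -deriveE // !mxE mulrC summxE.
congr (_ * _); rewrite (bigD1 j) //= !mxE !eqxx mulr1 big1 ?addr0 //.
by move=> i ij; rewrite !mxE eq_sym (negbTE ij) mulr0.
Qed.

Lemma is_derive_qform n (M : 'M[R]_n) (e : R -> 'cV[R]_n) (t : R) (d : 'cV[R]_n) :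
  M^T = M -> (forall j, is_derive t 1 (fun r => e r j 0) (d j 0)) ->
  is_derive t 1 (fun r => qform M (e r)) (2 * dot (e t) (M *m d)).
Proof.
move=> symM De.
have -> : (fun r => qform M (e r)) = \sum_i ((fun r => e r i 0) *
    \sum_j (M i j \*: (fun r => e r j 0))).
  apply/funext => r; rewrite qform_dot dotE fct_sumE; apply: eq_bigr => i _.
  by rewrite /= -[RHS]/(_ * _) fct_sumE !mxE.
apply: is_derive_eq.
rewrite mulr_natl mulr2n {2}(dot_sym _ _ symM) !dotE -big_split /=.
apply: eq_bigr => i _; rewrite fct_sumE !mxE.
by congr (_ + _); rewrite [RHS]mulrC.
Qed.

(** By the mean value theorem u(t) exp(- c t) does not increase. Differentiability is asked in the
    open interval only and [c] may have either sign, so one lemma serves both phases up to their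
    switching times. *)
Lemma gronwall u (du : R -> R) (a b c : R) : a <= b ->
  {within `[a, b], continuous u} ->
  (forall t, a < t < b -> is_derive t 1 u (du t)) ->
  (forall t, a < t < b -> du t <= c * u t) ->
  u b <= u a * expR (c * (b - a)).
Proof.
move=> ab cu Du du_le.
have [->|nab] := eqVneq a b; first by rewrite subrr mulr0 expR0 mulr1.
have {nab} ab' : a < b by rewrite lt_def eq_sym nab.
pose w t := u t * expR (- c * t).
have Dw t : t \in `]a, b[ -> is_derive t 1 w ((du t - c * u t) * expR (- c * t)).
  rewrite in_itv /= => tab.
  have dut := Du t tab.
  have dct : is_derive t 1 ( *%R (- c)) (- c).
    by apply: is_derive_eq (is_deriveZ (- c) (is_derive_id t 1)) _; rewrite scaler1.
  have det := is_derive1_comp (is_derive_expR (- c * t)) dct.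
  apply: is_derive_eq (is_deriveM dut det) _.
  by rewrite /= ![_ *: _]mulrC /=; ring.
have ce : continuous (fun t => expR (- c * t)).
  move=> s; apply: (@continuous_comp _ _ _ ( *%R (- c)) expR).
    exact: mulrl_continuous.
  exact: continuous_expR.
have cw : {within `[a, b], continuous w}.
  move=> t; apply: (@cvgM _ (subspace `[a, b])); first exact: cu.
  move: t.
  exact: continuous_subspaceT.
have [t tab E] := MVT ab' Dw cw.
have : w b <= w a.
  rewrite -subr_le0 E mulr_le0_ge0 ?subr_ge0 // mulr_le0_ge0 ?expR_ge0 //.
  by rewrite subr_le0 du_le //; move: tab; rewrite in_itv.
rewrite /w !mulNr !expRN mulrBr expRD expRN ler_pdivrMr ?expR_gt0 //.
by rewrite mulrAC mulrA.
Qed.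

Lemma continuous_within_dist (D : set R) u (t : R) : {within D, continuous u} ->
  D t -> forall e, 0 < e -> exists2 d, 0 < d &
    forall s, D s -> `|t - s| < d -> `|u t - u s| < e.
Proof.
move=> cu Dt e e0.
have /subspace_continuousP/(_ t Dt)/cvgrPdist_lt/(_ e e0)[d /= d0 Hd] := cu.
by exists d => // s Ds ts; exact: Hd.
Qed.

(** Bootstrap: the step hypothesis improves a weak bound on the past into a strict bound at the
    present, which leaves continuity no way to reach [g]. *)
Lemma continuation h (g : R) : {within `[0, +oo[, continuous h} -> h 0 < g ->
  (forall t, 0 <= t -> (forall r, 0 <= r <= t -> h r <= g) -> h t < g) ->
  forall t, 0 <= t -> h t < g.
Proof.
move=> ch h0 hstep t t_ge0; rewrite ltNge; apply/negP => ht.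
(* [inf S] would be the first exit time, where [h] is both [>= g] and [< g]. *)
pose S := [set r | 0 <= r /\ g <= h r].
have lbS : has_lbound S by exists 0 => r [].
have S0 : S !=set0 by exists t.
have it0 : 0 <= inf S by apply: lb_le_inf => // r [].
have below r : 0 <= r -> r < inf S -> h r < g.
  move=> r0 rS; rewrite ltNge; apply/negP => hr.
  by move: rS; rewrite ltNge => /negP; apply; apply: ge_inf.
have i0 : `[0, +oo[%classic (inf S) by rewrite /= in_itv /= it0.
have le_g : h (inf S) <= g.
  rewrite leNgt; apply/negP => hi.
  have [|d d0 Hd] := continuous_within_dist ch i0 (e := h (inf S) - g); first by lra.
  have i1 : 0 < inf S.
    rewrite lt_def it0 andbT; apply/negP => /eqP E; rewrite E in hi; lra.
  (* A time just before [inf S], cut off at 0 to stay in the domain; there h < g, although h stays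
     close to h (inf S) > g. *)
  pose r := Num.max 0 (inf S - d / 2).
  have r0 : 0 <= r by rewrite le_max lexx.
  have rS : r < inf S by rewrite gt_max i1 ltrBlDr ltrDl divr_gt0.
  have dr : inf S - d / 2 <= r by rewrite le_max lexx orbT.
  have hr := below r r0 rS.
  have := Hd r; rewrite /= in_itv /= r0 => /(_ isT).
  rewrite gtr0_norm ?subr_gt0 // => /(_ _)/(le_lt_trans (ler_norm _)).
  lra.
have lt_g : h (inf S) < g.
  apply: hstep => // r /andP[r0]; rewrite le_eqVlt => /predU1P[->//|rS].
  exact/ltW/below.
(* Elements of [S], where h >= g, lie arbitrarily close to [inf S]; continuity contradicts the
   strict inequality there. *)
have [|d d0 Hd] := continuous_within_dist ch i0 (e := g - h (inf S)); first by lra.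
have [s [s0 hs] sd] := inf_adherent d0 (conj S0 lbS).
have si : inf S <= s by apply: ge_inf.
have := Hd s; rewrite /= in_itv /= s0 => /(_ isT).
rewrite distrC ger0_norm ?subr_ge0 // ltrBlDl => /(_ sd).
rewrite distrC => /(le_lt_trans (ler_norm _)).
lra.
Qed.
End Calculus.

(** * Switched exponential bounds *)

Section Switching.
Variables (R : realType) (t s : nat -> R) (W : R -> R).
Variables (theta T m1 m2 tau : R).
Hypothesis ts : intermittent t s.
Hypotheses (theta_le : forall m, theta <= s m - t m).
Hypotheses (T_ge : forall m, t m.+1 - t m <= T).
Hypotheses (m1_ge0 : 0 <= m1) (m2_ge0 : 0 <= m2).
Hypothesis W_ge0 : forall r, 0 <= r <= tau -> 0 <= W r.
Hypothesis decay : forall m a b, t m <= a -> a <= b -> b <= s m -> b <= tau ->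
  W b <= W a * expR (- m1 * (b - a)).
Hypothesis growth : forall m a b, s m <= a -> a <= b -> b <= t m.+1 -> b <= tau ->
  W b <= W a * expR (m2 * (b - a)).
Hypothesis tau_ge0 : 0 <= tau.

Let rho := m1 * theta - m2 * (T - theta).

Lemma communication_ge0 m : 0 <= t m.
Proof.
have [t0 lt_ts lt_st _] := ts; elim: m => [|m IHm]; first by rewrite t0.
exact: le_trans IHm (ltW (lt_trans (lt_ts m) (lt_st m))).
Qed.

(** Converts elapsed time into a count of periods: this is what turns a decay per period into a
    decay in time. *)
Lemma communication_le m : t m <= m%:R * T.
Proof.
have [t0 _ _ _] := ts; elim: m => [|m IHm]; first by rewrite t0 mul0r.
by have := T_ge m; rewrite -natr1 mulrDl mul1r; lra.
Qed.

(* The exponent is [- m1 a + m2 b] with [a >= theta] and [a + b <= T] over a full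
   period; the decay during communication is dropped inside a period. *)
Lemma switched_bound m r : t m <= r -> r <= t m.+1 -> r <= tau ->
  exists2 x, W r <= W (t m) * expR x &
    x <= m2 * (T - theta) /\ (r = t m.+1 -> x <= - rho).
Proof.
move=> tr rt r_tau; have [_ lt_ts lt_st _] := ts.
have t_ge0 := communication_ge0 m.
have := theta_le m; have := T_ge m => HT Htheta.
have T_theta : 0 <= T - theta by have := lt_st m; lra.
have m2T := mulr_ge0 m2_ge0 T_theta.
have [rs|sr] := leP r (s m).
  exists (- m1 * (r - t m)); first exact: (@decay m).
  (* The claim on a full period is vacuous here: [t m.+1] comes after [s m]. *)
  split=> [|E]; last by have := lt_st m; lra.
  by rewrite mulNr (le_trans _ m2T) // oppr_le0 mulr_ge0 // subr_ge0.
exists (- m1 * (s m - t m) + m2 * (r - s m)).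
  rewrite expRD mulrA.
  have s_tau : s m <= tau by lra.
  apply: le_trans (@growth m _ _ (lexx _) (ltW sr) rt r_tau) _.
  by rewrite ler_wpM2r ?expR_ge0 // (@decay m) // ltW // lt_ts.
have H1 : m2 * (r - s m) <= m2 * (T - theta) by rewrite ler_wpM2l //; lra.
have H2 : 0 <= m1 * (s m - t m) by rewrite mulr_ge0 // subr_ge0 ltW.
split=> [|rE]; first lra.
have := ler_wpM2l m1_ge0 Htheta; rewrite /rho; lra.
Qed.

Lemma switched_decay_communication m : t m <= tau ->
  W (t m) <= W 0 * expR (- (rho * m%:R)).
Proof.
have [t0 lt_ts lt_st _] := ts.
elim: m => [|m IHm] tm; first by rewrite t0 mulr0 oppr0 expR0 mulr1.
have lt_tt := lt_trans (lt_ts m) (lt_st m).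
have [x Wx [_ /(_ erefl) x_le]] := switched_bound (ltW lt_tt) (lexx _) tm.
apply: le_trans Wx _; apply: le_trans (_ : _ <= W 0 * expR (- (rho * m%:R)) * expR x) _.
  by rewrite ler_wpM2r ?expR_ge0 // IHm // (le_trans (ltW lt_tt)).
rewrite -mulrA -expRD ler_wpM2l ?W_ge0 ?lexx // ler_expR -natr1; lra.
Qed.

(** With [m] complete periods before [tau], the m-fold decay loses at most one factor exp(rho)
    against exp(rho tau / T), since tau < t_(m+1) <= (m + 1) T. The unfinished period costs at most
    exp(m2 (T - theta)). *)
Lemma switched_decay : 0 < rho -> 0 < T ->
  W tau <= W 0 * expR (rho + m2 * (T - theta) - rho / T * tau).
Proof.
move=> rho_gt0 T_gt0; have [t0 lt_ts lt_st t_oo] := ts.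
have ex_t : exists m, tau < t m.
  have [m _ /(_ m (leqnn m)) Hm] := (cvgryPgt t).1 t_oo tau.
  by exists m.
case: (ex_minnP ex_t) => -[|m] Hm min_m; first by rewrite t0 ltNge tau_ge0 in Hm.
have tm : t m <= tau.
  by rewrite leNgt; apply/negP => /min_m; rewrite ltnn.
have [x Wx [x_le _]] := switched_bound tm (ltW Hm) (lexx _).
apply: le_trans Wx _; apply: le_trans (_ : _ <= W 0 * expR (- (rho * m%:R)) * expR x) _.
  by rewrite ler_wpM2r ?expR_ge0 // switched_decay_communication.
rewrite -mulrA -expRD ler_wpM2l ?W_ge0 ?lexx // ler_expR.
suff : rho / T * tau <= rho * m%:R + rho by lra.
have -> : rho * m%:R + rho = rho * m.+1%:R by rewrite -natr1 mulrDr mulr1.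
rewrite mulrAC ler_pdivrMr // -mulrA ler_wpM2l ?(ltW rho_gt0) //.
exact: le_trans (ltW Hm) (communication_le _).
Qed.

End Switching.

(** * Matrices of the statement *)

Section MatrixFacts.
Variable R : realType.

Lemma mx22_sym (a b d : R) : (mx22 a b b d)^T = mx22 a b b d.
Proof. by have := @tr_block_mx R 1 1 1 1 a%:M b%:M b%:M d%:M; rewrite !tr_scalar_mx. Qed.

Lemma dot_col_mx m n (u u' : 'cV[R]_m) (v v' : 'cV[R]_n) :
  dot (col_mx u v) (col_mx u' v') = dot u u' + dot v v'.
Proof. by rewrite /dot tr_col_mx mul_row_col mxE. Qed.

Lemma dot_scalar (x y : R) : dot (x%:M : 'cV_1) (y%:M) = x * y.
Proof. by rewrite dotE big_ord1 !mxE. Qed.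

Lemma qform_mx22 (a b c d x y : R) :
  qform (mx22 a b c d) (col_mx (x%:M : 'cV_1) (y%:M : 'cV_1) : 'cV_(1 + 1)) =
  a * x ^+ 2 + (b + c) * (x * y) + d * y ^+ 2.
Proof.
rewrite qform_dot /mx22.
have -> := @mul_block_col R 1 1 1 1 1 a%:M b%:M c%:M d%:M x%:M y%:M.
have -> := @dot_col_mx 1 1 x%:M.
by rewrite -!scalar_mxM -!raddfD /= !dot_scalar; ring.
Qed.

Lemma sqr_enorm_col11 (x y : R) :
  enorm (col_mx (x%:M : 'cV_1) (y%:M : 'cV_1)) ^+ 2 = x ^+ 2 + y ^+ 2.
Proof.
by rewrite sqr_enorm dot_col_mx !dot_scalar -!expr2.
Qed.

Lemma lambda_min_gt0 n (M : 'M[R]_n) : (0 < n)%N -> M^T = M ->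
  (forall v, v != 0 -> 0 < qform M v) -> 0 < lambda_min M.
Proof.
move=> n_gt0 symM pM; have [_ [v v1 <-]] := lambda_min_attained n_gt0 symM.
by apply: pM; rewrite -enorm_eq0 v1 oner_eq0.
Qed.

(** Sylvester's criterion in dimension two, by completing the square after multiplication by [a]. *)
Lemma lambda_min_mx22_gt0 (a b d : R) : 0 < a -> b ^+ 2 < a * d ->
  0 < lambda_min (mx22 a b b d).
Proof.
move=> a0 bad; apply: lambda_min_gt0 => //; first exact: mx22_sym.
move=> v v0; pose x := usubmx (v : 'cV_(1 + 1)) 0 0; pose y := dsubmx (v : 'cV_(1 + 1)) 0 0.
have vE : v = col_mx (x%:M : 'cV_1) (y%:M : 'cV_1) :> 'cV_(1 + 1).
  by rewrite -!mx11_scalar vsubmxK.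
rewrite vE qform_mx22; rewrite vE -enorm_eq0 -sqrf_eq0 sqr_enorm_col11 in v0.
rewrite -(pmulr_rgt0 _ a0).
have -> : a * (a * x ^+ 2 + (b + b) * (x * y) + d * y ^+ 2) =
   (a * x + b * y) ^+ 2 + (a * d - b ^+ 2) * y ^+ 2 by ring.
have bad' : 0 < a * d - b ^+ 2 by lra.
have [y0|y0] := eqVneq y 0.
  rewrite y0 expr0n addr0 in v0; rewrite y0 expr0n /= !mulr0 !addr0 exprMn.
  by apply: mulr_gt0; [exact: exprn_gt0|rewrite lt_def v0 sqr_ge0].
by rewrite ltr_wpDl ?sqr_ge0 // mulr_gt0 // lt_def sqr_ge0 expf_eq0 y0.
Qed.

Lemma posdef_opnorm_gt0 n (M : 'M[R]_n) : (0 < n)%N -> posdef M -> 0 < opnorm M.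
Proof.
move=> n_gt0 [_ pM]; rewrite lt_def opnorm_ge0 andbT; apply/negP => /eqP M0.
pose v : 'cV[R]_n := delta_mx (Ordinal n_gt0) 0.
have v0 : v != 0.
  apply/eqP => /colP/(_ (Ordinal n_gt0)); rewrite !mxE !eqxx => /eqP.
  by rewrite oner_eq0.
have := enorm_mulmx_le M v; rewrite M0 mul0r => Mv.
have /eqP : enorm (M *m v) == 0 by rewrite eq_le Mv enorm_ge0.
move=> /eqP; rewrite enorm_eq0 => /eqP Mv0.
by have := pM v v0; rewrite qform_dot Mv0 /dot mulmx0 mxE ltxx.
Qed.

Lemma sum_mxtens m n (F : 'I_(m * n) -> R) :
  \sum_p F p = \sum_i \sum_j F (mxtens_index (i, j)).
Proof.
rewrite pair_big /=; rewrite (reindex (@mxtens_index m n)) /=.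
  by apply: eq_bigr => -[i j].
by exists (@mxtens_unindex m n) => p _; [exact: mxtens_indexK|exact: mxtens_unindexK].
Qed.

Lemma enorm_le_coord n (u : 'cV[R]_n) (b : 'I_n -> R) c : 0 <= c ->
  (forall i, `|u i 0| <= b i) -> \sum_i b i ^+ 2 <= c ^+ 2 -> enorm u <= c.
Proof.
move=> c0 ub bc; rewrite -(ler_pXn2r (n := 2)) ?nnegrE ?enorm_ge0 //.
apply: le_trans bc; rewrite sqr_enormE; apply: ler_sum => i _.
by rewrite -real_normK ?num_real // lerXn2r ?nnegrE // (le_trans _ (ub i)).
Qed.

(** Stacking n copies of [x] multiplies the squared norm by n: this is the origin of the sqrt N in
    [pi2]. *)
Lemma enorm_ones_tens n (x : 'cV[R]_n) :
  enorm (ones_tens x) = Num.sqrt n%:R * enorm x.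
Proof.
apply/eqP; rewrite -(@eqrXn2 _ 2) ?mulr_ge0 ?enorm_ge0 ?sqrtr_ge0 //.
rewrite exprMn !sqr_enormE sum_mxtens (sqr_sqrtr (ler0n _ _)).
apply/eqP; rewrite (eq_bigr (fun=> \sum_i x i 0 ^+ 2)).
  by rewrite sumr_const card_ord mulr_natl.
move=> i _; apply: eq_bigr => j _.
by rewrite /ones_tens mxE !mxtens_indexK !mxE mul1r (ord1 (_.2)).
Qed.

Lemma kmax_ge n (k : 'I_n -> R) i : k i <= kmax k.
Proof. by rewrite /kmax le_bigmax. Qed.

Lemma enorm_diag_mul n (k : 'I_n -> R) (v : 'cV[R]_n) : (forall i, 0 < k i) ->
  enorm (diag_mx (\row_i k i) *m v) <= kmax k * enorm v.
Proof.
move=> k0; have kmax0 : 0 <= kmax k.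
  by apply: bigmax_ge_id.
apply: (@enorm_le_coord _ _ (fun i => kmax k * `|v i 0|)).
- by rewrite mulr_ge0 ?enorm_ge0.
- move=> i; rewrite mul_diag_mx !mxE normrM gtr0_norm // ler_wpM2r //.
  exact: kmax_ge.
- rewrite exprMn sqr_enormE mulr_sumr; apply: ler_sum => i _.
  by rewrite exprMn real_normK ?num_real.
Qed.

(** The identity factor keeps the second index fixed, so L acts as a consensus term on each
    coordinate [j] separately; [Bmx] adds the pinning term. *)
Lemma LBmxE N (A : 'M[R]_N) (v : 'cV[R]_(N * N)) i j :
  (LBmx A *m v) (mxtens_index (i, j)) 0 =
  \sum_k A i k * (v (mxtens_index (i, j)) 0 - v (mxtens_index (k, j)) 0)
  + A i j * v (mxtens_index (i, j)) 0.
Proof.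
rewrite /LBmx mulmxDl mxE; congr (_ + _); last first.
  by rewrite /Bmx mul_diag_mx !mxE mxtens_indexK.
rewrite mxE sum_mxtens.
transitivity (\sum_k laplacian A i k * v (mxtens_index (k, j)) 0).
  apply: eq_bigr => k _; rewrite (bigD1 j) //= tensmxE [1%:M j j]mxE eqxx mulr1.
  rewrite big1 ?addr0 // => l lj.
  by rewrite tensmxE [1%:M _ _]mxE eq_sym (negbTE lj) mulr0 mul0r.
rewrite /laplacian; under eq_bigr do rewrite !mxE mulrBl.
rewrite sumrB (bigD1 i) //= eqxx mulr1n [X in _ * _ + X]big1 ?addr0.
  by rewrite mulr_suml -sumrB; apply: eq_bigr => k _; rewrite mulrBr.
by move=> k ki; rewrite eq_sym (negbTE ki) mulr0n mul0r.
Qed.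

End MatrixFacts.

(** * Nash equilibrium and Lyapunov drift *)

Section Nash.
Variables (R : realType) (N : nat).
Implicit Types (f : 'I_N -> 'cV[R]_N -> R) (x : 'cV[R]_N).

(** Fermat's rule along each player's own action line, on which the payoff is maximal at the
    equilibrium. *)
Lemma dG_nash f x : (forall i y, differentiable (f i) y) -> nash f x ->
  dG f x = 0.
Proof.
move=> df nx; apply/colP => i; rewrite !mxE.
pose e (r : R) := set_action x i (x i 0 + r).
have De (t : R) j : is_derive t 1 (fun r => e r j 0) ((delta_mx i 0 : 'cV[R]_N) j 0).
  rewrite !mxE eqxx andbT; have [->|ji] := eqVneq j i.
    have -> : (fun r => e r i 0) = cst (x i 0) + id.
      by apply/funext => r; rewrite /e mxE eqxx.
    have Dx := is_deriveD (is_derive_cst (x i 0) t 1) (is_derive_id t 1).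
    by apply: is_derive_eq Dx _; rewrite add0r.
  have -> : (fun r => e r j 0) = cst (x j 0).
    by apply/funext => r; rewrite /e mxE (negbTE ji).
  exact: is_derive_cst.
have e0 : e 0 = x.
  by apply/colP => j; rewrite mxE addr0; case: eqVneq => [->|].
have Dfe (t : R) : is_derive t 1 (f i \o e) (dot (grad (f i) (e t)) (delta_mx i 0)).
  by apply: is_derive_grad_comp => //; exact: De.
have c0 : (0 : R) \in `]-1, 1[ by rewrite in_itv /= ltrN10 ltr01.
have D0 : is_derive (0 : R) 1 (f i \o e) 0.
  apply: (derive1_at_max (a := -1) (b := 1)) c0 _ => [|t _|t _].
  - by lra.
  - by have [] := Dfe t.
  - by rewrite /= e0; exact: nx.
have [_ D1] := Dfe 0; have [_ D2] := D0; rewrite D1 e0 in D2.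
rewrite -D2 dotE (bigD1 i) //= big1 => [|j ji].
  by rewrite !mxE !eqxx mulr1 addr0.
by rewrite !mxE (negbTE ji) mulr0.
Qed.
End Nash.

Section Lyapunov.
Variables (R : realType) (N : nat).
Local Notation state := 'cV[R]_(N + N * N).
Variable xs : 'cV[R]_N.
Implicit Types (z : state) (f : 'I_N -> 'cV[R]_N -> R).

Definition err z : 'cV[R]_N := usubmx z - xs.

Definition dis z : 'cV[R]_(N * N) := dsubmx z - ones_tens (usubmx z).

(** The gradient that the players actually follow: component [i] is taken at player i's own
    estimate. It equals [dG f] at the true actions once all estimates are exact. *)
Definition pgrad f z : 'cV[R]_N := \col_i partial i (f i) (est z i).

Lemma disE z i j : dis z (mxtens_index (i, j)) 0 = est z i j 0 - act z j.
Proof.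
rewrite /dis /est /act !mxE; congr (_ - _).
by rewrite mxtens_indexK mul1r (ord1 (mxtens_unindex _).2).
Qed.

(** The common x_j cancels in y_ij - y_kj, and y_ij - x_j is an entry of e_x; hence the field is
    linear in e_x. *)
Lemma est_fieldE (A : 'M[R]_N) z i j :
  est_field A z i j = (- (LBmx A *m dis z)) (mxtens_index (i, j)) 0.
Proof.
rewrite /est_field [RHS]mxE LBmxE !disE; congr (- (_ + _)); apply: eq_bigr => k _.
by rewrite disE; ring.
Qed.

(** Player i's Lipschitz bound involves only its own block of e_x, and the squares of the blocks add
    up to |e_x|^2; so no factor N appears. *)
Lemma enorm_pgrad_sub f alpha z : 0 <= alpha -> lipschitz_dG f alpha ->
  enorm (pgrad f z - dG f (usubmx z)) <= alpha * enorm (dis z).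
Proof.
move=> alpha0 lipf.
apply: (@enorm_le_coord _ _ _ (fun i => alpha * enorm (est z i - usubmx z))).
- by rewrite mulr_ge0 ?enorm_ge0.
- by move=> i; rewrite !mxE; exact: lipf.
rewrite exprMn sqr_enormE sum_mxtens mulr_sumr; apply: ler_sum => i _.
rewrite exprMn ler_wpM2l ?sqr_ge0 // sqr_enormE; apply: ler_sum => j _.
by rewrite disE /act !mxE.
Qed.

(** Here all N components share the same bound, which costs sqrt N; together with the sqrt N of
    [ones_tens] it gives the N in [pi1]. *)
Lemma enorm_dG_le f alpha x : 0 <= alpha -> lipschitz_dG f alpha ->
  dG f xs = 0 -> enorm (dG f x) <= Num.sqrt N%:R * alpha * enorm (x - xs).
Proof.
move=> alpha0 lipf dG0.
apply: (@enorm_le_coord _ _ _ (fun i => alpha * enorm (x - xs))).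
- by rewrite !mulr_ge0 ?enorm_ge0 ?sqrtr_ge0.
- move=> i; have := lipf i x xs; have /colP/(_ i) := dG0; rewrite !mxE => ->.
  by rewrite subr0.
by rewrite sumr_const card_ord -mulrA [leRHS]exprMn sqr_sqrtr ?ler0n // mulr_natl.
Qed.

Section Rate.
Variables (f : 'I_N -> 'cV[R]_N -> R) (k : 'I_N -> R) (P : 'M[R]_(N * N)).
Variables (Vbar : 'cV[R]_N -> R) (alpha gamma1 gamma2 gamma3 gamma4 gamma5 : R).
Hypothesis alpha_gt0 : 0 < alpha.
Hypothesis lipf : lipschitz_dG f alpha.
Hypothesis dG0 : dG f xs = 0.
Hypothesis k_gt0 : forall i, 0 < k i.
Hypothesis Vbar_lyap :
  lyapunov_reduced f k xs Vbar gamma1 gamma2 gamma3 gamma4 gamma5.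

Lemma kmax_ge0 : 0 <= kmax k.
Proof. exact: bigmax_ge_id. Qed.

(** The contribution of the moving actions, common to both phases. Split [pgrad] into [dG] at the
    true actions and a remainder of size alpha |e_x|. The first part gives the gamma3 term; the
    remainder against grad Vbar gives the gamma4 half of [pi1]. In the P-term the remainder gives
    [pi2], and [dG] gives the N ||P|| half of [pi1]. *)
Lemma lyapunov_drift_le eps z v : 0 <= eps -> enorm (err z) <= gamma5 ->
  v = eps *: (diag_mx (\row_i k i) *m pgrad f z) ->
  dot (grad Vbar (err z)) v + 2 * dot (dis z) (P *m - ones_tens v) <=
  - (eps * gamma3) * enorm (err z) ^+ 2
  + 2 * (eps * pi1 P k alpha gamma4) * (enorm (err z) * enorm (dis z))
  + eps * pi2 P k alpha * enorm (dis z) ^+ 2.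
Proof.
move=> eps0 ez vE.
have [_ /(_ _ ez)[_ Vdec Vgrad]] := Vbar_lyap.
set e := err z in ez Vdec Vgrad *; set d := dis z.
set K := diag_mx _ in vE Vdec.
have xE : xs + e = usubmx z by rewrite /e /err addrC subrK.
have K0 := kmax_ge0; have e0 := enorm_ge0 e; have d0 := enorm_ge0 d.
have sN : 0 <= Num.sqrt N%:R :> R by exact: sqrtr_ge0.
have g1 := enorm_pgrad_sub z (ltW alpha_gt0) lipf.
have g2 := enorm_dG_le (usubmx z) (ltW alpha_gt0) lipf dG0.
rewrite -/d in g1; rewrite -/(err z) -/e in g2.
set w := pgrad f z - dG f (usubmx z) in g1.
have wE : pgrad f z = dG f (usubmx z) + w by rewrite /w addrC subrK.
have H1 : dot (grad Vbar e) v <= eps * (- gamma3 * enorm e ^+ 2) +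
    eps * (gamma4 * enorm e * (kmax k * (alpha * enorm d))).
  rewrite vE dotZr wE mulmxDr dotDr mulrDr lerD // ler_wpM2l //.
    by rewrite -xE; move: Vdec; rewrite -mulmxA.
  apply: le_trans (ler_norm _) _; apply: le_trans (dot_enorm_le _ _) _.
  rewrite ler_pM ?enorm_ge0 //.
  by apply: le_trans (enorm_diag_mul _ k_gt0) _; rewrite ler_wpM2l.
have Hv : enorm v <=
    eps * (kmax k * (alpha * enorm d + Num.sqrt N%:R * alpha * enorm e)).
  rewrite vE enormZ ger0_norm // ler_wpM2l //.
  apply: le_trans (enorm_diag_mul _ k_gt0) _; rewrite ler_wpM2l //.
  by rewrite wE addrC; apply: le_trans (enormD _ _) _; rewrite lerD.
have H2 : dot d (P *m - ones_tens v) <= enorm d * (opnorm P * (Num.sqrt N%:R *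
    (eps * (kmax k * (alpha * enorm d + Num.sqrt N%:R * alpha * enorm e))))).
  apply: le_trans (ler_norm _) _; apply: le_trans (dot_enorm_le _ _) _.
  rewrite ler_wpM2l //; apply: le_trans (enorm_mulmx_le _ _) _.
  by rewrite ler_wpM2l ?opnorm_ge0 // enormN enorm_ones_tens ler_wpM2l.
have sqN : Num.sqrt N%:R * Num.sqrt N%:R = N%:R :> R.
  by rewrite -expr2 sqr_sqrtr ?ler0n.
have := lerD H1 (ler_wpM2l (ler0n R 2) H2); move/le_trans; apply.
rewrite le_eqVlt; apply/orP; left; apply/eqP; rewrite /pi1 /pi2.
by move: sqN; set q := Num.sqrt N%:R => <-; field.
Qed.

End Rate.
End Lyapunov.

(** * Derivative of the energy along solutions *)

Section Trajectory.
Variables (R : realType) (N : nat).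
Local Notation state := 'cV[R]_(N + N * N).
Variables (xs : 'cV[R]_N) (P : 'M[R]_(N * N)) (Vbar : 'cV[R]_N -> R).
Hypothesis symP : P^T = P.
Hypothesis Vbar_diff : forall e, differentiable Vbar e.

Definition energy (z : state) : R := V Vbar P (err xs z) (dis z).

(** The velocities are arguments, so that communication and silence are two instances of one
    formula. *)
Definition energy_rate (z : state) (dx : 'cV[R]_N) (dy : 'cV[R]_(N * N)) : R :=
  dot (grad Vbar (err xs z)) dx + 2 * dot (dis z) (P *m (dy - ones_tens dx)).

Lemma continuous_err : continuous (err xs).
Proof.
apply: continuous_cV => i.
rewrite (_ : (fun w => err xs w i 0) = (fun w => w (lshift _ i) 0 - xs i 0)); last first.
  by apply/funext => w; rewrite !mxE.
move=> z; apply: (@continuousB _ _ _ (fun w : state => w (lshift (N * N) i) 0)).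
  exact: coord_continuous.
exact: cst_continuous.
Qed.

Lemma continuous_dis : continuous (@dis R N).
Proof.
apply: continuous_cV => p.
case: (mxtens_indexP p) => i j.
have E w : dis w (mxtens_index (i, j)) 0 =
    w (rshift N (mxtens_index (i, j))) 0 - w (lshift (N * N) j) 0.
  by rewrite disE /est /act !mxE.
under eq_fun do rewrite E.
move=> z; apply: (@continuousB _ _ _
  (fun w : state => w (rshift N (mxtens_index (i, j))) 0)).
  exact: coord_continuous.
exact: coord_continuous.
Qed.

Lemma continuous_energy : continuous energy.
Proof.
move=> z; apply: (@continuousD _ _ _ (Vbar \o err xs) (qform P \o @dis R N)).
  apply: continuous_comp; first exact: continuous_err.
  exact/differentiable_continuous/Vbar_diff.
apply: continuous_comp; first exact: continuous_dis.
exact: continuous_qform.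
Qed.

Lemma is_derive_energy (z : R -> state) (t : R)
    (dx : 'cV[R]_N) (dy : 'cV[R]_(N * N)) :
  (forall i, is_derive t 1 (fun r => act (z r) i) (dx i 0)) ->
  (forall i j, is_derive t 1 (fun r => est (z r) i j 0) (dy (mxtens_index (i, j)) 0)) ->
  is_derive t 1 (energy \o z) (energy_rate (z t) dx dy).
Proof.
move=> Dx Dy; apply: is_deriveD.
  apply: (is_derive_grad_comp (e := err xs \o z)) => // j.
  have -> : (fun r => (err xs \o z) r j 0) = (fun r => act (z r) j) - cst (xs j 0).
    by apply/funext => r; rewrite -[RHS]/(act (z r) j - xs j 0) /act !mxE.
  by apply: is_derive_eq (is_deriveB (Dx j) (is_derive_cst _ _ _)) _; rewrite subr0.
apply: (is_derive_qform (e := @dis R N \o z)) => // p.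
case: (mxtens_indexP p) => i j.
have -> : (fun r => (@dis R N \o z) r (mxtens_index (i, j)) 0) =
    (fun r => est (z r) i j 0) - (fun r => act (z r) j).
  by apply/funext => r /=; rewrite disE.
apply: is_derive_eq (is_deriveB (Dy i j) (Dx j)) _.
rewrite !mxE mxtens_indexK mul1r (ord1 (mxtens_unindex _).2); congr (_ - _).
Qed.

Variables (A : 'M[R]_N) (f : 'I_N -> 'cV[R]_N -> R) (k : 'I_N -> R).
Variables (eps : R) (t s : nat -> R) (z : R -> state).
Hypothesis ts : intermittent t s.
Hypothesis zsol : solution A f k eps t s z.

Lemma act_fieldE w : \col_i act_field eps k f w i =
  eps *: (diag_mx (\row_i k i) *m pgrad f w).
Proof.
by apply/colP => i; rewrite mul_diag_mx !mxE /act_field mulrA.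
Qed.

Lemma energy_growth (a b c : R) (dy : state -> 'cV[R]_(N * N)) :
  0 <= a -> a <= b ->
  (forall r, a < r < b -> forall i j,
    is_derive r 1 (fun q => est (z q) i j 0) (dy (z r) (mxtens_index (i, j)) 0)) ->
  (forall r, a < r < b ->
    energy_rate (z r) (\col_i act_field eps k f (z r) i) (dy (z r)) <= c * energy (z r)) ->
  energy (z b) <= energy (z a) * expR (c * (b - a)).
Proof.
move=> a0 ab Dy rate; have [zc Dx _ _] := zsol.
apply: (gronwall (u := energy \o z)
  (du := fun r =>
     energy_rate (z r) (\col_i act_field eps k f (z r) i) (dy (z r)))) => //.
  have zab : {within `[a, b], continuous z}.
    apply: continuous_subspaceW zc => r /=; rewrite !in_itv /= andbT.
    by move=> /andP[/(le_trans a0)].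
  move=> r; apply: (@continuous_comp (subspace `[a, b])); first exact: zab.
  exact: continuous_energy.
move=> r rab; have /andP[ar rb] := rab.
have r0 : 0 < r by exact: le_lt_trans a0 ar.
apply: is_derive_energy => [i|]; last exact: Dy.
(* As r > a >= 0 is interior, the derivative relative to the half-line is two-sided. *)
rewrite mxE; apply: (is_derive_within_derive (D := `[0, +oo[)).
  have : \forall q \near r, q \in `]0, +oo[ by apply: near_in_itvoy; rewrite in_itv /= r0.
  by apply: filterS => q; rewrite /= !in_itv /= !andbT => /ltW.
by apply: Dx; rewrite in_itv /= (ltW r0).
Qed.

Variables (theta T m1 m2 gamma : R).
Hypothesis theta_le : forall m, theta <= s m - t m.
Hypothesis T_ge : forall m, t m.+1 - t m <= T.
Hypotheses (T_gt0 : 0 < T) (m1_ge0 : 0 <= m1) (m2_ge0 : 0 <= m2).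
Hypothesis rho_gt0 : 0 < m1 * theta - m2 * (T - theta).
Hypothesis energy_ge0 : forall w, enorm (err xs w) <= gamma -> 0 <= energy w.
Hypothesis communication_rate : forall w, enorm (err xs w) <= gamma ->
  energy_rate w (\col_i act_field eps k f w i) (- (LBmx A *m dis w))
    <= - m1 * energy w.
Hypothesis silence_rate : forall w, enorm (err xs w) <= gamma ->
  energy_rate w (\col_i act_field eps k f w i) 0 <= m2 * energy w.

Lemma energy_decay (tau : R) : 0 <= tau ->
  (forall r, 0 <= r <= tau -> enorm (err xs (z r)) <= gamma) ->
  energy (z tau) <= energy (z 0) *
    expR (m1 * theta - m2 * (T - theta) + m2 * (T - theta)
          - (m1 * theta - m2 * (T - theta)) / T * tau).
Proof.
move=> tau0 small; have [_ lt_ts lt_st _] := ts.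
have [_ _ Dcom Dsil] := zsol.
have t0 := communication_ge0 ts.
apply: (switched_decay (W := energy \o z) ts theta_le T_ge) => //.
- by move=> r rtau; apply/energy_ge0/small.
- move=> m a b ta ab bs btau; have a0 := le_trans (t0 m) ta.
  apply: (energy_growth (dy := fun w => - (LBmx A *m dis w))) => // r /andP[ar rb].
    move=> i j; rewrite -est_fieldE.
    apply: (is_derive_within_derive (D := `[t m, s m[)).
      have : \forall q \near r, q \in `]t m, s m[.
        apply: near_in_itvoo; rewrite in_itv /=.
        by rewrite (le_lt_trans ta ar) (lt_le_trans rb bs).
      by apply: filterS => q; rewrite /= !in_itv /= => /andP[/ltW -> ->].
    by apply: Dcom; rewrite in_itv /= (ltW (le_lt_trans ta ar)) (lt_le_trans rb bs).
  apply/communication_rate/small.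
  by rewrite (ltW (le_lt_trans a0 ar)) (ltW (lt_le_trans rb btau)).
- move=> m a b sa ab bt btau; have a0 := le_trans (le_trans (t0 m) (ltW (lt_ts m))) sa.
  apply: (energy_growth (dy := fun w => 0)) => // r /andP[ar rb].
    move=> i j; rewrite mxE.
    apply: (is_derive_within_derive (D := `[s m, t m.+1[)).
      have : \forall q \near r, q \in `]s m, t m.+1[.
        apply: near_in_itvoo; rewrite in_itv /=.
        by rewrite (le_lt_trans sa ar) (lt_le_trans rb bt).
      by apply: filterS => q; rewrite /= !in_itv /= => /andP[/ltW -> ->].
    by apply: Dsil; rewrite in_itv /= (ltW (le_lt_trans sa ar)) (lt_le_trans rb bt).
  apply/silence_rate/small.
  by rewrite (ltW (le_lt_trans a0 ar)) (ltW (lt_le_trans rb btau)).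
Qed.

End Trajectory.

(** * Growth rates of the energy *)

Section Rates.
Variables (R : realType) (N : nat).
Local Notation state := 'cV[R]_(N + N * N).
Hypothesis N_gt0 : (0 < N)%N.
Variables (A : 'M[R]_N) (P Q : 'M[R]_(N * N)).
Hypotheses (P_pd : posdef P) (Q_pd : posdef Q).
Hypothesis PQ_eq : (LBmx A)^T *m P + P *m LBmx A = Q.
Variables (f : 'I_N -> 'cV[R]_N -> R) (k : 'I_N -> R) (xs : 'cV[R]_N).
Variables (Vbar : 'cV[R]_N -> R) (alpha gamma1 gamma2 gamma3 gamma4 gamma5 : R).
Hypotheses (alpha_gt0 : 0 < alpha) (lipf : lipschitz_dG f alpha).
Hypotheses (dG0 : dG f xs = 0) (k_gt0 : forall i, 0 < k i).
Hypotheses (gamma3_gt0 : 0 < gamma3) (gamma4_gt0 : 0 < gamma4).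
Hypothesis Vbar_lyap :
  lyapunov_reduced f k xs Vbar gamma1 gamma2 gamma3 gamma4 gamma5.
Variables eta1 eta2 : R.
Hypotheses (eta1_gt0 : 0 < eta1) (eta2_gt0 : 0 < eta2).
Hypothesis eta_bounds : V_bounds Vbar P gamma5 eta1 eta2.

Local Notation W := (energy xs P Vbar).
Local Notation dW := (energy_rate xs P Vbar).
Local Notation pi_1 := (pi1 P k alpha gamma4).
Local Notation pi_2 := (pi2 P k alpha).

Let NN_gt0 : (0 < N * N)%N.
Proof. by rewrite muln_gt0 N_gt0. Qed.

Lemma kmax_gt0 : 0 < kmax k.
Proof. by apply: lt_le_trans (k_gt0 (Ordinal N_gt0)) (kmax_ge _ _). Qed.

Lemma pi1_gt0 : 0 < pi_1.
Proof.
rewrite /pi1 !mulr_gt0 ?kmax_gt0 // ltr_pwDl ?divr_gt0 //.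
by rewrite mulr_ge0 ?opnorm_ge0.
Qed.

Lemma pi2_gt0 : 0 < pi_2.
Proof.
by rewrite /pi2 !mulr_gt0 ?kmax_gt0 ?posdef_opnorm_gt0 // sqrtr_gt0 ltr0n.
Qed.

Lemma lambda_min_Q_gt0 : 0 < lambda_min Q.
Proof. by case: Q_pd => symQ pQ; exact: lambda_min_gt0. Qed.

Lemma eps_star_gt0 : 0 < eps_star P Q k alpha gamma3 gamma4.
Proof.
have p1 := pi1_gt0; have p2 := pi2_gt0; have lQ := lambda_min_Q_gt0.
rewrite lt_min; apply/andP; split; apply: divr_gt0; rewrite ?exprn_gt0 //.
- exact: mulr_gt0.
- by apply: addr_gt0; [exact: mulr_gt0|exact: exprn_gt0].
- by apply: mulr_gt0; exact: exprn_gt0.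
Qed.

Variable eps : R.
Hypothesis eps_gt0 : 0 < eps.

(** [eps1] is the value of eps > 0 at which det Gamma1 vanishes; below it the determinant is
    positive. *)
Lemma lambda_min_Gamma1_gt0 : eps < eps_star P Q k alpha gamma3 gamma4 ->
  0 < lambda_min (Gamma1 P Q k alpha gamma3 gamma4 eps).
Proof.
have p1 := pi1_gt0; have p2 := pi2_gt0; have lQ := lambda_min_Q_gt0.
rewrite lt_min => /andP[+ _].
rewrite /eps1 ltr_pdivlMr; last first.
  by apply: addr_gt0; [exact: mulr_gt0|exact: exprn_gt0].
move=> eps_lt; apply: lambda_min_mx22_gt0; first exact: mulr_gt0.
rewrite -subr_gt0.
have -> : eps * gamma3 * (lambda_min Q - eps * pi_2) - (- (eps * pi_1)) ^+ 2 =
  eps * (gamma3 * lambda_min Q - eps * (gamma3 * pi_2 + pi_1 ^+ 2)) by ring.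
by apply: mulr_gt0 => //; rewrite subr_gt0.
Qed.

(** The form takes the value sqrt(eps) gamma3 at (1, 0). The sign is what allows |e|^2 + |e_x|^2 <=
    V / eta1 to be multiplied by this eigenvalue. *)
Lemma lambda_max_Gamma2_ge0 : 0 <= lambda_max (Gamma2 P k alpha gamma3 gamma4 eps).
Proof.
have := lambda_max_ge (col_mx (1%:M : 'cV_1) (0%:M : 'cV_1) : 'cV_(1 + 1))
  isT (mx22_sym (Num.sqrt eps * gamma3) (eps * pi_1) (eps * pi_2)).
rewrite qform_mx22 sqr_enorm_col11 expr1n expr0n /= !mulr0 !addr0 !mulr1.
by apply: le_trans; rewrite mulr_ge0 ?sqrtr_ge0 // ltW.
Qed.

Lemma energy_bounds (w : state) : enorm (err xs w) <= gamma5 ->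
  eta1 * (enorm (err xs w) ^+ 2 + enorm (dis w) ^+ 2) <= W w
    <= eta2 * (enorm (err xs w) ^+ 2 + enorm (dis w) ^+ 2).
Proof. exact: eta_bounds. Qed.

Lemma energy_ge0 (w : state) : enorm (err xs w) <= gamma5 -> 0 <= W w.
Proof.
move=> /energy_bounds/andP[+ _]; apply: le_trans.
by rewrite mulr_ge0 ?addr_ge0 ?sqr_ge0 ?ltW.
Qed.

Lemma energy_rate_le (w : state) dy : enorm (err xs w) <= gamma5 ->
  dW w (\col_i act_field eps k f w i) dy <=
  - (eps * gamma3) * enorm (err xs w) ^+ 2
  + 2 * (eps * pi_1) * (enorm (err xs w) * enorm (dis w))
  + eps * pi_2 * enorm (dis w) ^+ 2 + 2 * dot (dis w) (P *m dy).
Proof.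
move=> small; rewrite /energy_rate mulmxDr dotDr mulrDr.
have := lyapunov_drift_le P alpha_gt0 lipf dG0 k_gt0 Vbar_lyap
  (ltW eps_gt0) small (act_fieldE f k eps w).
lra.
Qed.

Lemma communication_rate (w : state) :
  eps < eps_star P Q k alpha gamma3 gamma4 -> enorm (err xs w) <= gamma5 ->
  dW w (\col_i act_field eps k f w i) (- (LBmx A *m dis w))
    <= - mu1 P Q k alpha gamma3 gamma4 eta2 eps * W w.
Proof.
move=> eps_lt small; set X := enorm (err xs w); set Y := enorm (dis w).
apply: le_trans (energy_rate_le _ small) _.
have [symP _] := P_pd; have [symQ _] := Q_pd.
have [HQ _] := lambda_min_attained NN_gt0 symQ.
(* By symmetry of [P], both summands of the Lyapunov equation have the same quadratic form. *)
have QE : qform Q (dis w) = 2 * dot (dis w) (P *m (LBmx A *m dis w)).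
  rewrite qform_dot -PQ_eq mulmxDl dotDr -!mulmxA mulr_natl mulr2n; congr (_ + _).
  rewrite (dot_sym _ _ symP) /dot trmx_mul -!mulmxA.
  by [].
have := HQ (dis w); rewrite QE -/Y => HY.
have [Hmin _] := lambda_min_attained (n := 2) isT
  (mx22_sym (eps * gamma3) (- (eps * pi_1)) (lambda_min Q - eps * pi_2)).
have := Hmin (col_mx (X%:M : 'cV_1) (Y%:M : 'cV_1) : 'cV_(1 + 1)).
rewrite qform_mx22 sqr_enorm_col11 => {}Hmin.
have /andP[_ hi] := energy_bounds small; rewrite -/X -/Y in hi.
(* Positivity lets V / eta2 <= X^2 + Y^2 be multiplied by the eigenvalue; here eps < [eps_star]
   enters. *)
have l0 := lambda_min_Gamma1_gt0 eps_lt.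
have : mu1 P Q k alpha gamma3 gamma4 eta2 eps * W w <=
    lambda_min (Gamma1 P Q k alpha gamma3 gamma4 eps) * (X ^+ 2 + Y ^+ 2).
  rewrite /mu1 -mulrA ler_wpM2l ?(ltW l0) //.
  by rewrite -(ler_pM2l eta2_gt0) mulrA mulfV ?gt_eqF // mul1r.
rewrite /Gamma1 => Hmu.
rewrite mulmxN dotNr mulrN mulNr -/X -/Y.
lra.
Qed.

Lemma silence_rate (w : state) : enorm (err xs w) <= gamma5 ->
  dW w (\col_i act_field eps k f w i) 0
    <= mu2 P k alpha gamma3 gamma4 eta1 eps * W w.
Proof.
move=> small; set X := enorm (err xs w); set Y := enorm (dis w).
apply: le_trans (energy_rate_le _ small) _.
rewrite mulmx0 -(scale0r 0) dotZr mul0r mulr0 addr0.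
have := lambda_max_ge (col_mx (X%:M : 'cV_1) (Y%:M : 'cV_1) : 'cV_(1 + 1))
  isT (mx22_sym (Num.sqrt eps * gamma3) (eps * pi_1) (eps * pi_2)).
rewrite qform_mx22 sqr_enorm_col11 => Hmax.
have /andP[lo _] := energy_bounds small; rewrite -/X -/Y in lo.
have l0 := lambda_max_Gamma2_ge0.
have : lambda_max (Gamma2 P k alpha gamma3 gamma4 eps) * (X ^+ 2 + Y ^+ 2) <=
    mu2 P k alpha gamma3 gamma4 eta1 eps * W w.
  rewrite /mu2 -mulrA ler_wpM2l //.
  by rewrite -(ler_pM2l eta1_gt0) mulrA mulfV ?gt_eqF // mul1r.
apply: le_trans; apply: le_trans Hmax; rewrite -/X -/Y.
(* The gap between the form of Gamma2, with sqrt(eps) gamma3 before X^2, and the drift, with - eps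
   gamma3. *)
have : 0 <= (Num.sqrt eps * gamma3 + eps * gamma3) * X ^+ 2.
  by rewrite mulr_ge0 ?sqr_ge0 // addr_ge0 ?mulr_ge0 ?sqrtr_ge0 ?ltW.
lra.
Qed.

End Rates.

(** * Equilibrium and exponential stability *)

Section Equilibrium.
Variables (R : realType) (N : nat).
Local Notation state := 'cV[R]_(N + N * N).
Variable xs : 'cV[R]_N.
Let zs : state := col_mx xs (ones_tens xs).

Lemma is_derive_within_cst (D : set R) (c t : R) : is_derive_within D (fun=> c) t 0.
Proof.
rewrite /is_derive_within (_ : (fun r => _) = cst 0); first exact: cvg_cst.
by apply/funext => r; rewrite subrr mul0r.
Qed.

Lemma dis_equilibrium : dis zs = 0.
Proof. by rewrite /dis col_mxKu col_mxKd subrr. Qed.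

Lemma est_equilibrium i : est zs i = xs.
Proof.
apply/colP => j; have := disE zs i j; rewrite dis_equilibrium mxE /act col_mxKu.
by move/esym/eqP; rewrite subr_eq0 => /eqP.
Qed.

Lemma equilibrium_consensus A f k eps t s : dG f xs = 0 ->
  equilibrium (solution A f k eps t s) zs.
Proof.
move=> dG0; split=> [|i tau _|m i j tau _|m i j tau _].
- by move=> r; exact: cst_continuous.
- rewrite /act_field est_equilibrium.
  have -> : partial i (f i) xs = 0 by have /colP/(_ i) := dG0; rewrite !mxE.
  rewrite mulr0.
  exact: is_derive_within_cst.
- rewrite est_fieldE dis_equilibrium mulmx0 oppr0 [X in is_derive_within _ _ _ X]mxE.
  exact: is_derive_within_cst.
- exact: is_derive_within_cst.
Qed.

Lemma sqr_enormD_le n (u v : 'cV[R]_n) :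
  enorm (u + v) ^+ 2 <= 2 * enorm u ^+ 2 + 2 * enorm v ^+ 2.
Proof.
apply: le_trans (_ : (enorm u + enorm v) ^+ 2 <= _).
  by rewrite lerXn2r ?nnegrE ?addr_ge0 ?enorm_ge0 ?enormD.
have := sqr_ge0 (enorm u - enorm v); rewrite sqrrB sqrrD; lra.
Qed.

Lemma ones_tensB (x y : 'cV[R]_N) : ones_tens (x - y) = ones_tens x - ones_tens y.
Proof. by apply/matrixP => p q; rewrite !mxE !mul1r. Qed.

Lemma sqr_enorm_state z :
  enorm (z - zs) ^+ 2 = enorm (err xs z) ^+ 2 + enorm (dsubmx z - ones_tens xs) ^+ 2.
Proof.
rewrite -{1}[z]vsubmxK opp_col_mx add_col_mx sqr_enorm dot_col_mx.
by rewrite -!sqr_enorm.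
Qed.

Lemma sqr_enorm_ones_err (z : state) :
  enorm (ones_tens (err xs z)) ^+ 2 = N%:R * enorm (err xs z) ^+ 2.
Proof. by rewrite enorm_ones_tens exprMn sqr_sqrtr ?ler0n. Qed.

(** The two coordinate systems differ by the shear y - 1 (x) x* = e_x + 1 (x) e, whose last term has
    squared norm N |e|^2; hence 2 + 2N here and in the converse bound. *)
Lemma sqr_enorm_state_le z : enorm (z - zs) ^+ 2 <=
  (2 + 2 * N%:R) * (enorm (err xs z) ^+ 2 + enorm (dis z) ^+ 2).
Proof.
rewrite sqr_enorm_state.
have -> : dsubmx z - ones_tens xs = dis z + ones_tens (err xs z).
  by rewrite /dis /err ones_tensB addrA subrK.
have := sqr_enormD_le (dis z) (ones_tens (err xs z)); rewrite sqr_enorm_ones_err.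
have := mulr_ge0 (ler0n R N) (sqr_ge0 (enorm (dis z))).
have := sqr_ge0 (enorm (err xs z)).
lra.
Qed.

Lemma sqr_enorm_err_dis_le z : enorm (err xs z) ^+ 2 + enorm (dis z) ^+ 2 <=
  (2 + 2 * N%:R) * enorm (z - zs) ^+ 2.
Proof.
rewrite sqr_enorm_state; set D := dsubmx z - ones_tens xs.
have -> : dis z = D + - ones_tens (err xs z).
  by rewrite /dis /err ones_tensB opprB addrA subrK.
have := sqr_enormD_le D (- ones_tens (err xs z)); rewrite enormN sqr_enorm_ones_err.
have := mulr_ge0 (ler0n R N) (sqr_ge0 (enorm D)).
have := sqr_ge0 (enorm (err xs z)).
lra.
Qed.

Lemma enorm_err_le z : enorm (err xs z) <= enorm (z - zs).
Proof.
rewrite -(ler_pXn2r (n := 2)) ?nnegrE ?enorm_ge0 // sqr_enorm_state lerDl.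
exact: sqr_ge0.
Qed.

End Equilibrium.

Theorem theorem2 (R : realType) (N : nat) (N_gt0 : (0 < N)%N)
  (E : rel 'I_N) (E_irr : irreflexive E) (E_sc : strongly_connected E)
  (A : 'M[R]_N) (A_adj : weighted_adjacency E A)
  (P Q : 'M[R]_(N * N))
  (P_diag : is_diag_mx P) (P_pd : posdef P) (Q_pd : posdef Q)
  (PQ_eq : (LBmx A)^T *m P + P *m LBmx A = Q)
  (f : 'I_N -> 'cV[R]_N -> R)
  (A2 : forall i, C2 (f i))
  (alpha : R) (alpha_gt0 : 0 < alpha) (A3 : lipschitz_dG f alpha)
  (A4_concave : concave_own f)
  (beta : R) (beta_gt0 : 0 < beta) (A4_monotone : strongly_monotone_dG f beta)
  (xs : 'cV[R]_N) (xs_nash : nash f xs)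
  (k : 'I_N -> R) (k_gt0 : forall i, 0 < k i)
  (Vbar : 'cV[R]_N -> R) (gamma1 gamma2 gamma3 gamma4 gamma5 : R)
  (gamma1_gt0 : 0 < gamma1) (gamma2_gt0 : 0 < gamma2)
  (gamma3_gt0 : 0 < gamma3) (gamma4_gt0 : 0 < gamma4)
  (gamma5_gt0 : 0 < gamma5)
  (Vbar_lyap :
     lyapunov_reduced f k xs Vbar gamma1 gamma2 gamma3 gamma4 gamma5)
  (eta1 eta2 : R) (eta1_gt0 : 0 < eta1) (eta2_gt0 : 0 < eta2)
  (eta_bounds : V_bounds Vbar P gamma5 eta1 eta2) :
  exists eps : R,
    0 < eps < eps_star P Q k alpha gamma3 gamma4 /\
    forall (t s : nat -> R) (theta T : R),
      intermittent t s ->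
      ereal_inf [set (s m - t m)%:E | m in setT] = theta%:E ->
      ereal_sup [set (t m.+1 - t m)%:E | m in setT] = T%:E ->
      0 < theta -> theta < T ->
      0 < mu1 P Q k alpha gamma3 gamma4 eta2 eps * theta
          - mu2 P k alpha gamma3 gamma4 eta1 eps * (T - theta) ->
      let zs := col_mx xs (ones_tens xs) in
      equilibrium (solution A f k eps t s) zs /\
      exponentially_stable (solution A f k eps t s) zs.
Proof.
have dG0 : dG f xs = 0.
  by apply: dG_nash xs_nash => i x; have [[df _] _] := A2 i.
have es0 := eps_star_gt0 N_gt0 P_pd Q_pd alpha_gt0 k_gt0 gamma3_gt0 gamma4_gt0.
(* Any value in the interval would do; it has to be fixed before the switching times, [theta] and
   [T]. *)
pose eps := eps_star P Q k alpha gamma3 gamma4 / 2.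
have eps_gt0 : 0 < eps by rewrite divr_gt0.
have eps_lt : eps < eps_star P Q k alpha gamma3 gamma4 by rewrite /eps; lra.
exists eps; split=> [|t s]; first by rewrite eps_gt0.
move=> theta T ts Hinf Hsup theta_gt0 theta_T.
set m1 := mu1 _ _ _ _ _ _ _ _; set m2 := mu2 _ _ _ _ _ _ _ => rho_gt0 zs.
split; first exact: equilibrium_consensus.
have theta_le m : theta <= s m - t m.
  by rewrite -lee_fin -Hinf; apply: ereal_inf_lbound; exists m.
have T_ge m : t m.+1 - t m <= T.
  by rewrite -lee_fin -Hsup; apply: ereal_sup_ubound; exists m.
have T_gt0 : 0 < T := lt_trans theta_gt0 theta_T.
have m1_ge0 : 0 <= m1.
  by rewrite divr_ge0 ?(ltW eta2_gt0) // ltW // lambda_min_Gamma1_gt0.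
have m2_ge0 : 0 <= m2.
  by rewrite divr_ge0 ?(ltW eta1_gt0) //; exact: lambda_max_Gamma2_ge0.
have [symP _] := P_pd; have [[Vdiff _] _] := Vbar_lyap.
set rho := m1 * theta - m2 * (T - theta) in rho_gt0.
pose kappa : R := 2 + 2 * N%:R.
have kappa_gt0 : 0 < kappa by rewrite /kappa ltr_wpDr ?mulr_ge0.
(* [kappa] and [eta2] bound V(0) by |z(0) - zs|^2, the exponential is the overhead of the switched
   decay, and [eta1] returns from V to |e|^2 + |e_x|^2. *)
pose M := eta2 * kappa * expR (rho + m2 * (T - theta)) / eta1.
have M_gt0 : 0 < M by rewrite !mulr_gt0 ?expR_gt0 ?invr_gt0.
have sM : 1 <= Num.sqrt (M + 1) by rewrite -[leLHS]sqrtr1 ler_sqrt; lra.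
have sM0 : 0 < Num.sqrt (M + 1) by exact: lt_le_trans sM.
(* The radius forces M |z(0) - zs|^2 < gamma5^2, and the added 1 keeps it at most gamma5, so that
   the initial error is small too. The square root in the constant and the halved rate come from
   estimating squared norms. *)
exists (gamma5 / Num.sqrt (M + 1)), (Num.sqrt (kappa * M)), (rho / T / 2).
split; [exact: divr_gt0|by rewrite sqrtr_gt0 mulr_gt0|by rewrite !divr_gt0|].
move=> z zsol z0; set w0 := enorm (z 0 - zs) in z0 *.
have w0_ge0 : 0 <= w0 := enorm_ge0 _.
have w0_lt : (M + 1) * w0 ^+ 2 < gamma5 ^+ 2.
  rewrite ltr_pdivlMr // in z0.
  rewrite -[M + 1]sqr_sqrtr; last by lra.
  by rewrite -exprMn mulrC ltr_pXn2r ?nnegrE ?mulr_ge0 ?(ltW sM0) ?(ltW gamma5_gt0).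
have small0 : enorm (err xs (z 0)) <= gamma5.
  apply: le_trans (enorm_err_le _ _) _; apply: le_trans (ltW z0) _.
  by rewrite ler_pdivrMr // ler_peMr // ltW.
pose D r := enorm (err xs (z r)) ^+ 2 + enorm (dis (z r)) ^+ 2.
(* Used twice: under the smallness assumption to feed the continuation argument, then with smallness
   established to conclude. *)
have key tau : 0 <= tau ->
    (forall r, 0 <= r <= tau -> enorm (err xs (z r)) <= gamma5) ->
    D tau <= M * w0 ^+ 2 * expR (- (rho / T * tau)).
  move=> tau0 small.
  have smalltau : enorm (err xs (z tau)) <= gamma5 by apply: small; rewrite tau0 lexx.
  have := energy_decay symP Vdiff ts zsol theta_le T_ge T_gt0 m1_ge0 m2_ge0
    rho_gt0 (energy_ge0 eta1_gt0 eta_bounds)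
    (fun w => communication_rate N_gt0 P_pd Q_pd PQ_eq alpha_gt0 A3 dG0 k_gt0 gamma3_gt0
       gamma4_gt0 Vbar_lyap eta2_gt0 eta_bounds eps_gt0 (w := w) eps_lt)
    (silence_rate alpha_gt0 A3 dG0 k_gt0 gamma3_gt0 Vbar_lyap eta1_gt0
       eta_bounds eps_gt0) tau0 small.
  have /andP[lo _] := energy_bounds eta_bounds smalltau.
  have /andP[_ hi] := energy_bounds eta_bounds small0.
  rewrite -/rho expRD mulrA => Hdec.
  rewrite /M -(ler_pM2l eta1_gt0) /D; apply: le_trans lo _; apply: le_trans Hdec _.
  have -> : eta1 * (eta2 * kappa * expR (rho + m2 * (T - theta)) / eta1 * w0 ^+ 2
      * expR (- (rho / T * tau))) =
    eta2 * (kappa * w0 ^+ 2) * expR (rho + m2 * (T - theta)) * expR (- (rho / T * tau)).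
    by field; rewrite gt_eqF.
  do 2!rewrite ler_wpM2r ?expR_ge0 //.
  apply: le_trans hi _; rewrite ler_wpM2l ?(ltW eta2_gt0) //.
  exact: sqr_enorm_err_dis_le.
have err_cont : {within `[0, +oo[, continuous ((@enorm R N \o err xs) \o z)}.
  have [zc _ _ _] := zsol.
  move=> r; apply: (@continuous_comp (subspace `[(0 : R), +oo[)); first exact: zc.
  by apply: continuous_comp; [exact: continuous_err|exact: continuous_enorm].
have small : forall tau, 0 <= tau -> enorm (err xs (z tau)) < gamma5.
  apply: (continuation err_cont).
  - apply: le_lt_trans (enorm_err_le _ _) _; apply: lt_le_trans z0 _.
    by rewrite ler_pdivrMr // ler_peMr // ltW.
  move=> tau tau0 /(key _ tau0); rewrite /D => Hkey.
  rewrite -(ltr_pXn2r (n := 2)) ?nnegrE ?enorm_ge0 ?(ltW gamma5_gt0) //.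
  apply: le_lt_trans w0_lt.
  have e1 : expR (- (rho / T * tau)) <= 1.
    by rewrite expR_le1 oppr_le0 mulr_ge0 // divr_ge0 // ltW.
  apply: le_trans (_ : M * w0 ^+ 2 <= _); last by rewrite ler_wpM2r ?sqr_ge0 // lerDl.
  rewrite -[M * _]mulr1; apply: le_trans (ler_wpM2l _ e1); last first.
    by rewrite mulr_ge0 ?sqr_ge0 ?(ltW M_gt0).
  by apply: le_trans Hkey; rewrite lerDl sqr_ge0.
move=> tau tau0.
rewrite -(ler_pXn2r (n := 2)) ?nnegrE ?enorm_ge0 ?mulr_ge0 ?sqrtr_ge0 ?expR_ge0 //.
apply: le_trans (sqr_enorm_state_le _ _) _.
rewrite 2!exprMn [Num.sqrt (kappa * M) ^+ 2]sqr_sqrtr; last first.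
  by rewrite ltW // mulr_gt0.
rewrite -expRM_natl.
have -> : 2 * (- (rho / T / 2) * tau) = - (rho / T * tau) by field; rewrite gt_eqF.
rewrite -2!(mulrA kappa) ler_wpM2l ?(ltW kappa_gt0) //.
by apply: key => // r /andP[r0 _]; exact/ltW/small.
Qed.
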